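(* Let $n,l\in\mathbb{N}$, $\frac{nl}{2}<s\le nl$, $0<q<\infty$, $\max\{q,\frac{nl}{s}\}\le p_1,\dots,p_l<\infty$, and let $p$ be defined by $\frac1p=\frac1{p_1}+\cdots+\frac1{p_l}$. Assume that for every $\vec{w}=(w_1,\dots,w_l)\in A_{(\frac{p_1}{q},\dots,\frac{p_l}{q})}(\mathbb{R}^n)$ there is a constant $C_{\vec{w}}>0$ such that for every multilinear symbol $\sigma$ on $(\mathbb{R}^n)^l$ with $\sup_{k\in\mathbb{Z}}\|\sigma(2^k\,\cdot\,)\widehat{\Psi}\|_{L^2_s(\mathbb{R}^{nl})}<\infty$, $$\|T_\sigma\|_{L^{p_1}(w_1)\times\cdots\times L^{p_l}(w_l)\to L^p(v_{\vec{w}})}\le C_{\vec{w}}\,\sup_{k\in\mathbb{Z}}\|\sigma(2^k\,\cdot\,)\widehat{\Psi}\|_{L^2_s(\mathbb{R}^{nl})}.$$ Then $$q\ge \frac{nl}{s}.$$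
   Context: Fourier transform: $\widehat f(\xi)=\int f(x)e^{-2\pi i\langle x,\xi\rangle}\,dx$. $\mathscr{S}(\mathbb{R}^n)$ is the Schwartz class. A weight is a locally integrable function $w:\mathbb{R}^n\to[0,\infty)$, defined up to null sets and positive almost everywhere. For $0<p<\infty$, $\|f\|_{L^p(w)}=(\int_{\mathbb{R}^n}|f(x)|^pw(x)\,dx)^{1/p}$. Multiple weights: for $1\le r_1,\dots,r_l<\infty$ with $\frac1r=\frac1{r_1}+\cdots+\frac1{r_l}$, an $l$-tuple of weights $\vec{w}=(w_1,\dots,w_l)$ belongs to $A_{(r_1,\dots,r_l)}(\mathbb{R}^n)$ if $$\sup_Q\Big[\Big(\frac1{|Q|}\int_Q v_{\vec w}(x)\,dx\Big)^{\frac1r}\prod_{j=1}^l\Big(\frac1{|Q|}\int_Q w_j(x)^{1-r_j'}\,dx\Big)^{\frac1{r_j'}}\Big]<\infty,\qquad v_{\vec w}=\prod_{j=1}^l w_j^{\,r/r_j},$$ where the supremum is over all cubes $Q\subset\mathbb{R}^n$ with sides parallel to the axes, $r_j'=\frac{r_j}{r_j-1}$, and when $r_j=1$ the $j$-th factor of the product is understood as $(\operatorname{ess\,inf}_Q w_j)^{-1}$. With $r_j=p_j/q$ one has $r=p/q$, so $v_{\vec w}=\prod_{j=1}^l w_j^{\,p/p_j}$. For a (bounded) symbol $\sigma$ on $(\mathbb{R}^n)^l$, the multilinear Fourier multiplier operator is, for $f_1,\dots,f_l\in\mathscr{S}(\mathbb{R}^n)$, $$T_\sigma(f_1,\dots,f_l)(x)=\int_{(\mathbb{R}^n)^l}\sigma(\xi_1,\dots,\xi_l)\Big(\prod_{j=1}^l\widehat{f_j}(\xi_j)\Big)e^{2\pi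 i\langle x,\xi_1+\cdots+\xi_l\rangle}\,d\xi_1\cdots d\xi_l .$$ The bound $\|T_\sigma\|_{L^{p_1}(w_1)\times\cdots\times L^{p_l}(w_l)\to L^p(v_{\vec w})}\le C$ means $\|T_\sigma(f_1,\dots,f_l)\|_{L^p(v_{\vec w})}\le C\prod_{j=1}^l\|f_j\|_{L^{p_j}(w_j)}$ for all $f_1,\dots,f_l\in\mathscr{S}(\mathbb{R}^n)$. $\Psi$ is a fixed Schwartz function on $\mathbb{R}^{nl}$ with $\operatorname{supp}\widehat\Psi\subset\{\vec\xi\in(\mathbb{R}^n)^l:2^{-1}\le|\vec\xi|\le2\}$ and $\sum_{j\in\mathbb{Z}}\widehat\Psi(2^j\vec\xi)=1$ for $\vec\xi\ne0$. The Sobolev norm is $\|F\|_{L^2_s(\mathbb{R}^{nl})}=\big(\int_{\mathbb{R}^{nl}}(1+4\pi^2|\vec\xi|^2)^s|\widehat F(\vec\xi)|^2\,d\vec\xi\big)^{1/2}$. *)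

(* Defs.v *)
From HB Require Import structures.
From mathcomp Require Import all_boot all_order all_algebra.
From mathcomp Require Import complex.
From mathcomp Require Import all_classical all_reals all_analysis.
From mathcomp Require Import ess_sup_inf.

Set Implicit Arguments.
Unset Strict Implicit.
Unset Printing Implicit Defensive.

Import Order.TTheory GRing.Theory Num.Theory.
Import numFieldNormedType.Exports.

Local Open Scope classical_set_scope.
Local Open Scope ring_scope.
Local Open Scope complex_scope.

(* R^n is 'rV[R]_n = 'M[R]_(1, n) and (R^n)^l is 'M[R]_(l, n), the j-th row
   being the j-th vector.  Notions needed on both spaces are defined on
   'M[R]_(m, n), with the Borel sigma-algebra (generated by the entries). *)

Definition mx_display : measure_display.
Proof. exact: default_measure_display. Qed.

Section mx_measurable.
Context {R : realType} (m n : nat).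

Definition mx_measurable : set (set 'M[R]_(m, n)) :=
  <<s \bigcup_(ij in [set: 'I_m * 'I_n])
        preimage_set_system setT (fun x : 'M[R]_(m, n) => x ij.1 ij.2)
          measurable >>.

Let mx_measurable0 : mx_measurable set0.
Proof. exact: sigma_algebra0. Qed.

Let mx_measurableC A : mx_measurable A -> mx_measurable (~` A).
Proof. exact: sigma_algebraC. Qed.

Let mx_measurable_bigcup (F : (set 'M[R]_(m, n))^nat) :
  (forall i, mx_measurable (F i)) -> mx_measurable (\bigcup_i (F i)).
Proof. exact: sigma_algebra_bigcup. Qed.

HB.instance Definition _ := @isMeasurable.Build mx_display 'M[R]_(m, n)
  mx_measurable mx_measurable0 mx_measurableC mx_measurable_bigcup.

End mx_measurable.

Lemma pushforward_sigma_finite d1 d2 (T1 : measurableType d1)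
    (T2 : measurableType d2) (R : realType)
    (mu : set T1 -> \bar R) (f : T1 -> T2) (g : T2 -> T1) :
  measurable_fun setT g -> cancel f g ->
  sigma_finite setT mu -> sigma_finite setT (pushforward mu f).
Proof.
move=> mg fK [F FT Foo].
exists (fun k => g @^-1` F k).
  by rewrite -preimage_bigcup -FT preimage_setT.
move=> k; have [mF muF] := Foo k; split.
  by rewrite -[X in measurable X]setTI; exact: mg.
rewrite /pushforward -comp_preimage (_ : g \o f = id) ?preimage_id//.
exact/funext.
Qed.

(* The library has this instance, but canonical inference only finds the one
   for pairs of subprobabilities. *)
Lemma product_measure_sigma_finite d1 d2 (T1 : measurableType d1)
    (T2 : measurableType d2) (R : realType)
    (m1 : {sigma_finite_measure set T1 -> \bar R})
    (m2 : {sigma_finite_measure set T2 -> \bar R}) :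
  sigma_finite setT (m1 \x m2)%E.
Proof.
have /sigma_finiteP[F [TF ndF Foo]] := sigma_finiteT m1.
have /sigma_finiteP[G [TG ndG Goo]] := sigma_finiteT m2.
exists (fun k => F k `*` G k).
  apply/esym; rewrite -subTset => -[x y] _.
  have : [set: T1] x by []. rewrite TF => -[i _ Fix].
  have : [set: T2] y by []. rewrite TG => -[j _ Gjy].
  exists (maxn i j) => //; split.
  - by move: x Fix; exact/subsetPset/ndF/leq_maxl.
  - by move: y Gjy; exact/subsetPset/ndG/leq_maxr.
move=> k; have [? ?] := Foo k; have [? ?] := Goo k.
split; first exact: measurableX.
by rewrite product_measure1E// lte_mul_pinfty// ge0_fin_numE.
Qed.

Section lebesgue_tuple.
Context {R : realType}.

Definition tcons k (xt : R * k.-tuple R) : k.+1.-tuple R :=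
  [tuple of xt.1 :: xt.2].

Definition tuncons k (t : k.+1.-tuple R) : R * k.-tuple R :=
  (thead t, [tuple of behead t]).

Lemma tconsK k : cancel (@tcons k) (@tuncons k).
Proof. by case=> x t; congr pair => //; exact/val_inj. Qed.

Lemma measurable_tcons k : measurable_fun setT (@tcons k).
Proof. exact: measurable_cons. Qed.

Lemma measurable_tuncons k : measurable_fun setT (@tuncons k).
Proof.
apply/measurable_fun_pair; [exact: measurable_tnth|exact: measurable_behead].
Qed.

Section step.
Variables (k : nat) (mu : {sigma_finite_measure set (k.-tuple R) -> \bar R}).

Definition lebesgue_tcons : set (k.+1.-tuple R) -> \bar R :=
  pushforward (lebesgue_measure \x mu)%E (@tcons k).

Let lebesgue_tcons0 : lebesgue_tcons set0 = 0%E.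
Proof. by apply: measure0; exact: measurable_tcons. Qed.

Let lebesgue_tcons_ge0 A : (0 <= lebesgue_tcons A)%E.
Proof. by apply: measure_ge0; exact: measurable_tcons. Qed.

Let lebesgue_tcons_sigma_additive : semi_sigma_additive lebesgue_tcons.
Proof. by apply: measure_semi_sigma_additive; exact: measurable_tcons. Qed.

HB.instance Definition _ := isMeasure.Build _ _ _ lebesgue_tcons
  lebesgue_tcons0 lebesgue_tcons_ge0 lebesgue_tcons_sigma_additive.

Let lebesgue_tcons_sigma_finite : sigma_finite setT lebesgue_tcons.
Proof.
apply: pushforward_sigma_finite.
- exact: (@measurable_tuncons k).
- exact: (@tconsK k).
- exact: product_measure_sigma_finite.
Qed.

HB.instance Definition _ := Measure_isSigmaFinite.Build _ _ _ lebesgue_tcons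
  lebesgue_tcons_sigma_finite.

End step.

Fixpoint lebesgue_tuple k : {sigma_finite_measure set (k.-tuple R) -> \bar R} :=
  if k is k'.+1 then lebesgue_tcons (lebesgue_tuple k') else \d_[tuple].

Lemma lebesgue_tuple_box k (a b : 'I_k -> R) :
  (forall i, a i <= b i) ->
  lebesgue_tuple k [set t | forall i, a i <= tnth t i <= b i] =
  (\prod_i (b i - a i))%:E.
Proof.
elim: k a b => [|k IH] a b ab.
  rewrite /= big_ord0 diracE mem_set//; by case.
rewrite /= /lebesgue_tcons /pushforward.
rewrite (_ : _ @^-1` _ =
    (`[a ord0, b ord0]%classic : set (measurableTypeR R)) `*`
    [set t : k.-tuple R |
      forall i, a (lift ord0 i) <= tnth t i <= b (lift ord0 i)]); last first.
  apply/seteqP; split => [[x t] /= H|[x t] /= [H1 H2] i].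
    split; first by move: (H ord0); rewrite tnth0 in_itv.
    by move=> i; move: (H (lift ord0 i)); rewrite tnthS.
  case: (unliftP ord0 i) => [j ->|->]; first by rewrite tnthS.
  by rewrite tnth0; rewrite in_itv/= in H1.
rewrite product_measure1E.
- have E : @lebesgue_measure R `[a ord0, b ord0] = (b ord0 - a ord0)%:E.
    rewrite lebesgue_measure_itv/= lte_fin -EFinB; case: ltP => //.
    by move=> /(conj (ab ord0))/andP/le_anti ->; rewrite subrr.
  by rewrite big_ord_recl EFinM -E -(IH _ _ (fun i => ab (lift ord0 i))).
- exact: measurable_itv.
- rewrite (_ : mkset _ = \bigcap_(i in [set: 'I_k])
      ((fun t : k.-tuple R => tnth t i) @^-1`
        `[a (lift ord0 i), b (lift ord0 i)])).
    apply: fin_bigcap_measurable => // i _.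
    by rewrite -[X in measurable X]setTI; apply: measurable_tnth => //.
  apply/seteqP; split => [t /= H i _|t H i] /=; first by rewrite in_itv/=.
  by move: (H i I); rewrite /= in_itv.
Qed.

End lebesgue_tuple.

Section lebesgue_mx.
Context {R : realType} (m n : nat).

Definition mx_of_tuple (t : (m * n).-tuple R) : 'M[R]_(m, n) :=
  \matrix_(i, j) tnth t (mxvec_index i j).

Definition tuple_of_mx (x : 'M[R]_(m, n)) : (m * n).-tuple R :=
  [tuple mxvec x 0 k | k < m * n].

Lemma mx_of_tupleK : cancel mx_of_tuple tuple_of_mx.
Proof.
move=> t; apply: eq_from_tnth => k; rewrite tnth_mktuple.
by case/mxvec_indexP: k => i j; rewrite mxvecE mxE.
Qed.

Lemma measurable_entry (i : 'I_m) (j : 'I_n) :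
  measurable_fun setT (fun x : 'M[R]_(m, n) => x i j).
Proof.
move=> _ A mA; apply: sub_sigma_algebra; exists (i, j) => //.
by exists A.
Qed.

Lemma measurable_mx_of_tuple : measurable_fun setT mx_of_tuple.
Proof.
apply: measurability => // _ [_ [[i j] _ [A mA <-]] <-].
rewrite !setTI -comp_preimage.
rewrite (_ : _ \o _ = fun t => tnth t (mxvec_index i j)).
  by rewrite -[X in measurable X]setTI; exact: measurable_tnth.
by apply/funext => t /=; rewrite mxE.
Qed.

Lemma measurable_tuple_of_mx : measurable_fun setT tuple_of_mx.
Proof.
apply/measurable_fun_tnthP => k; case/mxvec_indexP: k => i j.
apply: (eq_measurable_fun (fun x : 'M[R]_(m, n) => x i j)).
  by move=> x _; rewrite /= tnth_mktuple mxvecE.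
exact: measurable_entry.
Qed.

Definition lebesgue_mx : set 'M[R]_(m, n) -> \bar R :=
  pushforward (lebesgue_tuple (m * n)) mx_of_tuple.

Let lebesgue_mx0 : lebesgue_mx set0 = 0%E.
Proof. by apply: measure0; exact: measurable_mx_of_tuple. Qed.

Let lebesgue_mx_ge0 A : (0 <= lebesgue_mx A)%E.
Proof. by apply: measure_ge0; exact: measurable_mx_of_tuple. Qed.

Let lebesgue_mx_sigma_additive : semi_sigma_additive lebesgue_mx.
Proof. by apply: measure_semi_sigma_additive; exact: measurable_mx_of_tuple. Qed.

HB.instance Definition _ := isMeasure.Build _ _ _ lebesgue_mx
  lebesgue_mx0 lebesgue_mx_ge0 lebesgue_mx_sigma_additive.

Let lebesgue_mx_sigma_finite : sigma_finite setT lebesgue_mx.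
Proof.
apply: pushforward_sigma_finite.
- exact: measurable_tuple_of_mx.
- exact: mx_of_tupleK.
- exact: sigma_finiteT.
Qed.

HB.instance Definition _ := Measure_isSigmaFinite.Build _ _ _ lebesgue_mx
  lebesgue_mx_sigma_finite.

Lemma lebesgue_mx_box (a b : 'M[R]_(m, n)) :
  (forall i j, a i j <= b i j) ->
  lebesgue_mx [set t | forall i j, a i j <= t i j <= b i j] =
  (\prod_i \prod_j (b i j - a i j))%:E.
Proof.
move=> ab; rewrite /lebesgue_mx /pushforward.
rewrite (_ : _ @^-1` _ =
    [set t | forall k, mxvec a 0 k <= tnth t k <= mxvec b 0 k]); last first.
  apply/seteqP; split => t /= H.
    by move=> k; case/mxvec_indexP: k => i j; move: (H i j); rewrite !mxvecE mxE.
  by move=> i j; move: (H (mxvec_index i j)); rewrite !mxvecE mxE.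
rewrite lebesgue_tuple_box.
  congr EFin; rewrite pair_big/= (reindex _ (curry_mxvec_bij m n))/=.
  by apply: eq_bigr => -[i j] _; rewrite !mxvecE.
by move=> k; case/mxvec_indexP: k => i j; rewrite !mxvecE.
Qed.

End lebesgue_mx.

Section fourier.
Context {R : realType} (m n : nat).
Local Notation V := 'M[R]_(m, n).
Local Notation leb := (@lebesgue_mx R m n).

Definition dot (x y : V) : R := \sum_i \sum_j x i j * y i j.

(* The norm `|x| of V is the sup norm. *)
Definition enorm (x : V) : R := Num.sqrt (dot x x).

Definition expi (t : R) : R[i] := cos t +i* sin t.

Definition cintegral (f : V -> R[i]) : R[i] :=
  (\int[leb]_x complex.Re (f x)) +i* (\int[leb]_x complex.Im (f x)).

Definition fourier (f : V -> R[i]) (xi : V) : R[i] :=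
  cintegral (fun x => f x * expi (- (2 * pi * dot x xi))).

Definition pderiv (s : seq ('I_m * 'I_n)) (h : V -> R) : V -> R :=
  foldr (fun ij g => 'D_(delta_mx ij.1 ij.2) g) h s.

(* Differentiability of all iterated partial derivatives is smoothness. *)
Definition schwartzR (h : V -> R) : Prop :=
  forall s : seq ('I_m * 'I_n),
    (forall x, differentiable (pderiv s h) x) /\
    (forall N : nat, exists C : R,
       forall x, (1 + enorm x) ^+ N * `|pderiv s h x| <= C).

Definition schwartz (f : V -> R[i]) : Prop :=
  schwartzR (fun x => complex.Re (f x)) /\ schwartzR (fun x => complex.Im (f x)).

Definition csupp (f : V -> R[i]) : set V := closure [set x | f x != 0].

Definition sobolev (s : R) (F : V -> R[i]) : \bar R :=
  ((\int[leb]_xi (((1 + 4 * pi ^+ 2 * enorm xi ^+ 2) `^ s *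
      Normc.normc (fourier F xi) ^+ 2)%:E)) `^ (2^-1))%E.

(* For each xi != 0 only finitely many summands are nonzero, by the support
   condition, so the finite-support sum is the sum over all integers. *)
Definition dyadic_partition (Psi : V -> R[i]) : Prop :=
  [/\ schwartz Psi,
      csupp (fourier Psi) `<=` [set xi | 2^-1 <= enorm xi <= 2] &
      forall xi : V, xi != 0 ->
        \sum_(j \in [set: int]) fourier Psi (2 ^ j *: xi) = 1].

Definition lp_norm (p : R) (w : V -> R) (f : V -> R[i]) : \bar R :=
  ((\int[leb]_x ((Normc.normc (f x) `^ p * w x)%:E)) `^ (p^-1))%E.

(* A weight is defined up to null sets; w is a Borel representative. *)
Definition weight (w : V -> R) : Prop :=
  [/\ measurable_fun setT w,
      forall x, 0 <= w x,
      {ae leb, forall x, 0 < w x} &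
      forall K : set V, compact K -> (\int[leb]_(x in K) (w x)%:E < +oo)%E].

Definition cube (a : V) (h : R) : set V :=
  [set x | forall i j, a i j <= x i j <= a i j + h].

Definition average (Q : set V) (f : V -> R) : \bar R :=
  ((leb Q)^-1 * \int[leb]_(x in Q) (f x)%:E)%E.

Definition ess_inf_on (Q : set V) (f : V -> R) : \bar R :=
  ess_inf leb (fun x => if x \in Q then (f x)%:E else +oo%E).

End fourier.

Section multilinear.
Context {R : realType} (n l : nat).
Local Notation E := 'rV[R]_n.

(* The exponent defined by 1/r = 1/r_1 + ... + 1/r_l. *)
Definition harmonic (r : 'I_l -> R) : R := (\sum_j (r j)^-1)^-1.

Definition joint_weight (r : 'I_l -> R) (w : 'I_l -> E -> R) (x : E) : R :=
  \prod_j w j x `^ (harmonic r / r j).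

(* The conjugate exponent is r / (r - 1), and the inverse of 0 in \bar R is
   +oo.  A weight may vanish on a null set, where a negative power is 0. *)
Definition dual_average (r : R) (Q : set E) (w : E -> R) : \bar R :=
  if r == 1 then ((ess_inf_on Q w)^-1)%E
  else (average Q (fun x => w x `^ (1 - r / (r - 1)))%R `^ ((r / (r - 1))^-1))%E.

Definition multiple_weight (r : 'I_l -> R) (w : 'I_l -> E -> R) : Prop :=
  (forall j, weight (w j)) /\
  (ereal_sup [set z | exists (a : E) (h : R), (0 < h)%R /\
     z = average (cube a h) (joint_weight r w) `^ (harmonic r)^-1 *
         \prod_j dual_average (r j) (cube a h) (w j)] < +oo)%E.

(* Each symbol with finite symbol_norm below (for s > n * l / 2) agrees almost
   everywhere with a bounded Borel one. *)
Definition symbol (sigma : 'M[R]_(l, n) -> R[i]) : Prop :=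
  [/\ measurable_fun setT (fun xi => complex.Re (sigma xi)),
      measurable_fun setT (fun xi => complex.Im (sigma xi)) &
      exists M : R, forall xi, Normc.normc (sigma xi) <= M].

Definition multiplier (sigma : 'M[R]_(l, n) -> R[i]) (f : 'I_l -> E -> R[i])
    (x : E) : R[i] :=
  cintegral (fun xi : 'M[R]_(l, n) =>
    sigma xi * (\prod_j fourier (f j) (row j xi)) *
    expi (2 * pi * dot x (\sum_j row j xi))).

Definition symbol_norm (s : R) (Psi sigma : 'M[R]_(l, n) -> R[i]) : \bar R :=
  ereal_sup (range (fun k : int =>
    sobolev s (fun xi => sigma (2 ^ k *: xi) * fourier Psi xi))).

Definition bounded_by (P : 'I_l -> R) (w : 'I_l -> E -> R) (p : R) (v : E -> R)
    (T : ('I_l -> E -> R[i]) -> E -> R[i]) (B : \bar R) : Prop :=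
  forall f : 'I_l -> E -> R[i], (forall j, schwartz (f j)) ->
    (lp_norm p v (T f) <= B * \prod_j lp_norm (P j) (w j) (f j))%E.

End multilinear.

(* Main.v *)
From HB Require Import structures.
Require Import Defs.
From mathcomp Require Import all_boot all_order all_algebra.
From mathcomp Require Import complex ring lra.
From mathcomp Require Import all_classical all_reals all_analysis.
From mathcomp Require Import measurable_realfun.

Set Implicit Arguments.
Unset Strict Implicit.
Unset Printing Implicit Defensive.

Import Order.TTheory GRing.Theory Num.Theory.
Import numFieldNormedType.Exports.

Local Open Scope classical_set_scope.
Local Open Scope ring_scope.
Local Open Scope complex_scope.

(** Suppose q < n l / s, so that all exponents r_j = P_j / q exceed 1. The bound
    then fails for one explicit tuple of weights, tested on functions of scale
    1 / N with N large.

    Let e be the all-one vector, u (x) = |x| ^ (- al) with s q / l < al < n, and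
    w_j (x) = u (x - e) u (x) ^ (1 - r_j): a weight with a pole at e and a zero at
    0, which approach the limit of the A_{r_j} condition as al tends to n. Their
    strengths add up in the test below. As u is an A_1 weight (rpow_A1), bounding
    one of the two factors pointwise and averaging the other shows that the tuple
    is a multiple weight (multiple_weight_two_pole).

    Let all f_j be the same smooth bump of scale 1 / N at 0, where w_j is about
    N ^ (- al (r_j - 1)), and let sigma be a smooth cutoff to frequencies of size
    del * N, times the character that translates each variable by e. The multiplier
    moves the bumps from 0 to e: its values within 1 / N of e are bounded
    below uniformly in N (multiplier_lower), because for small del all factors of
    the integrand have nearly the same argument. There the joint weight is
    about N ^ al. The translation by e costs only a factor N ^ s in the symbol norm
    (symbol_norm_osc_le). Comparing both sides of the bound gives

       N ^ ((al - n) / p) <= const * N ^ s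
            * prod_j N ^ (- (al (r_j - 1) + n) / P_j),

    and since 1 / p is the sum of the 1 / P_j this is N ^ (l al / q) <= const * N ^ s,
    which fails for large N because l al / q > s.

    The Sobolev bound is obtained from finite differences: the transform of a
    difference is the transform times a character minus one, so bounds for the
    differences of order M of a compactly supported function give decay of order M
    of its transform (fourier_decay). The transform of Psi has such bounds because
    Psi decays fast (iter_fdiff_fourier), bumps have them by the mean value theorem
    (iter_fdiff_bump), and products inherit them (normc_iter_fdiffM). *)

(** * Lebesgue measure on spaces of matrices *)

Section mx_measure.
Context {R : realType} (m n : nat).
Local Notation V := 'M[R]_(m, n).
Local Notation leb := (@lebesgue_mx R m n).

Lemma entry_le_norm (x : V) i j : `|x i j| <= `|x|.
Proof.
rewrite [leRHS]/Num.Def.normr /= mx_normrE.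
by apply/bigmax_geP; right => /=; exists (i, j).
Qed.

Lemma mx_norm_le (x : V) r : 0 <= r -> (forall i j, `|x i j| <= r) -> `|x| <= r.
Proof.
move=> r0 xr; rewrite [leLHS]/Num.Def.normr /= mx_normrE.
by apply/bigmax_leP; split.
Qed.

Definition box (a b : V) : set V := [set x | forall i j, a i j <= x i j <= b i j].

Lemma measurable_entry_set i j (A : set R) : measurable A ->
  measurable [set x : V | A (x i j)].
Proof.
by move=> mA; rewrite -[X in measurable X]setTI; exact: measurable_entry.
Qed.

Lemma measurable_box a b : measurable (box a b).
Proof.
rewrite (_ : box a b = \bigcap_(ij in [set: 'I_m * 'I_n])
   [set x : V | `[a ij.1 ij.2, b ij.1 ij.2]%classic (x ij.1 ij.2)]).
  by apply: fin_bigcap_measurable => // ij _; exact: measurable_entry_set.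
apply/seteqP; split => [x xab [i j] _|x xab i j] /=.
  by rewrite in_itv/=; exact: xab.
by have := xab (i, j) I; rewrite /= in_itv.
Qed.

Definition cball (c : V) (r : R) : set V := [set x | `|x - c| <= r].

Lemma cballE c r : 0 <= r ->
  cball c r = box (c - const_mx r) (c + const_mx r).
Proof.
move=> r0; apply/seteqP; split => [x xc i j|x xc] /=.
  have := le_trans (entry_le_norm (x - c) i j) xc.
  by rewrite !mxE ler_distl.
apply: mx_norm_le => // i j; have := xc i j.
by rewrite !mxE ler_distl.
Qed.

Lemma measurable_cball c r : measurable (cball c r).
Proof.
have [r0|r0] := leP 0 r; first by rewrite cballE//; exact: measurable_box.
rewrite (_ : cball c r = set0)//; apply/seteqP; split => // x /=.
by rewrite /cball/= => /(le_trans (normr_ge0 _)); rewrite leNgt r0.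
Qed.

Lemma lebesgue_cball c r : 0 <= r -> leb (cball c r) = ((2 * r) ^+ (m * n))%:E.
Proof.
move=> r0; rewrite cballE// lebesgue_mx_box; last first.
  by move=> i j; rewrite !mxE; lra.
congr EFin; rewrite (eq_bigr (fun=> (2 * r) ^+ n)).
  by rewrite prodr_const card_ord -exprM mulnC.
move=> i _; rewrite (eq_bigr (fun=> 2 * r)) ?prodr_const ?card_ord//.
by move=> j _; rewrite !mxE; ring.
Qed.

(** An open set is the union of the closed cubes inside it that have a rational
    center and the inverse of an integer as radius, and these are countably many. *)
Lemma open_mx_measurable (A : set V) : open A -> measurable A.
Proof.
move=> oA.
pose B (p : 'M[rat]_(m, n) * nat) := cball (map_mx ratr p.1) (p.2.+1%:R^-1 : R).
rewrite (_ : A = \bigcup_(p in [set p | B p `<=` A]) B p).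
  rewrite bigcup_mkcond; apply: countable_bigcupT_measurable => // p.
  by case: ifP => // _; exact: measurable_cball.
apply/seteqP; split => [x Ax|x [p pA Bx]]; last exact: pA.
have /nbhs_ballP[/= e e0 xeA] : nbhs x A by exact: open_nbhs_nbhs.
have [k ke] : exists k : nat, k.+1%:R^-1 * 2 < e :> R.
  have [k _ ke] := near_infty_natSinv_lt (PosNum (divr_gt0 e0 (ltr0n _ 2))).
  by exists k; have := ke k (leqnn k); rewrite /= ltr_pdivlMr.
have k0 : 0 < k.+1%:R^-1 :> R by rewrite invr_gt0.
have /choice[c cP] : forall ij : 'I_m * 'I_n,
    exists q : rat, ratr q \in `](x ij.1 ij.2 - k.+1%:R^-1), (x ij.1 ij.2 + k.+1%:R^-1)[%R.
  by move=> ij; apply: rat_in_itvoo; rewrite ltrBlDr -addrA ltrDl addr_gt0.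
have xB : B (\matrix_(i, j) c (i, j), k) x.
  apply: mx_norm_le; first exact: ltW.
  move=> i j; have := cP (i, j); rewrite in_itv/= !mxE ler_distl.
  by move: (k.+1%:R^-1) => r /andP[? ?]; lra.
exists (\matrix_(i, j) c (i, j), k) => // y By.
apply: xeA; rewrite mx_norm_ball /ball_/=.
rewrite (le_lt_trans _ ke)// mulr_natr mulr2n.
move: xB By; rewrite /B /cball /=; set c' := map_mx _ _ => xB By.
rewrite (_ : x - y = (x - c') - (y - c')); last by rewrite opprB addrA subrK.
by rewrite (le_trans (ler_normB _ _))// lerD.
Qed.

Lemma continuous_mx_measurable (f : V -> R) :
  continuous f -> measurable_fun setT f.
Proof.
move=> /continuousP cf; apply: (measurability _ (RGenOpens.measurableE R)) => //.
move=> _ [_ [a [b ->] <-]]; rewrite setTI; apply: open_mx_measurable.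
by apply: cf; exact: interval_open.
Qed.

Lemma box_empty (a b : V) i j : b i j < a i j -> box a b = set0.
Proof.
move=> ba; apply/seteqP; split => // x /(_ i j) /andP[ax xb].
by move: ba; rewrite ltNge (le_trans ax xb).
Qed.

Definition boxes : set (set V) := [set B | exists a b, B = box a b].

Lemma boxes_setI : setI_closed boxes.
Proof.
move=> _ _ [a [b ->]] [a' [b' ->]].
exists (\matrix_(i, j) Num.max (a i j) (a' i j)).
exists (\matrix_(i, j) Num.min (b i j) (b' i j)).
apply/seteqP; split => [x [x1 x2] i j|x xI].
  by rewrite !mxE ge_max le_min; have /andP[-> ->] := x1 i j; apply: x2.
by split=> i j; have := xI i j;
  rewrite !mxE ge_max le_min => /andP[/andP[? ?] /andP[? ?]]; apply/andP.
Qed.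

Lemma measurable_boxesE : (measurable : set (set V)) = <<s boxes >>.
Proof.
apply/seteqP; split.
  apply: smallest_sub; first exact: smallest_sigma_algebra.
  move=> _ [[i j] _ [A mA <-]].
  apply: (@measurability _ _ (g_sigma_algebraType boxes) R setT
    (fun x : V => x i j) _ (RGenCInfty.measurableE R)) => //.
  move=> _ [_ [r ->] <-]; rewrite setTI.
  pose c k : V := \matrix_(i', j')
    if (i', j') == (i, j) then r else - k%:R.
  rewrite (_ : _ @^-1` _ = \bigcup_k box (c k) (const_mx k%:R)).
    apply: (@bigcup_measurable _ (g_sigma_algebraType boxes)) => k _.
    by apply: sub_sigma_algebra; exists (c k), (const_mx k%:R).
  apply/seteqP; split => [x /=|x [k _ /(_ i j)]] /=; rewrite in_itv/= andbT.
    move=> rx; exists (Num.truncn `|x|).+1 => //= i' j'.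
    have /ltW := le_lt_trans (entry_le_norm x i' j') (archimedean.Num.Theory.truncnS_gt `|x|).
    by rewrite !mxE ler_norml; case: eqP => [[-> ->]|_ //]; rewrite rx => /andP[].
  by rewrite !mxE eqxx => /andP[].
apply: smallest_sub; first exact: sigma_algebra_measurable.
by move=> _ [a [b ->]]; exact: measurable_box.
Qed.

Lemma measurable_shift (h : V) : measurable_fun setT (fun x : V => x + h).
Proof.
apply: measurability => // _ [_ [[i j] _ [B mB <-]] <-].
rewrite !setTI -comp_preimage.
rewrite (_ : _ @^-1` _ = [set x : V | ((fun t : R => t + h i j) @^-1` B) (x i j)]).
  apply: (@measurable_entry_set i j ((fun t : R => t + h i j) @^-1` B)).
  by rewrite -[X in measurable X]setTI; exact: measurable_funD.
by apply/seteqP; split => x /=; rewrite mxE.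
Qed.

Section shift.
Variable h : V.

Let shifted := pushforward leb (fun x : V => x + h).

Let shifted0 : shifted set0 = 0%E.
Proof. by apply: measure0; exact: measurable_shift. Qed.

Let shifted_ge0 A : (0 <= shifted A)%E.
Proof. by apply: measure_ge0; exact: measurable_shift. Qed.

Let shifted_sigma_additive : semi_sigma_additive shifted.
Proof. by apply: measure_semi_sigma_additive; exact: measurable_shift. Qed.

HB.instance Definition _ := isMeasure.Build _ _ _ shifted
  shifted0 shifted_ge0 shifted_sigma_additive.

(** The closed boxes form a pi-system generating the Borel sets, so it is enough
    to compare volumes of boxes. *)
Lemma lebesgue_mx_shift (A : set V) : measurable A -> shifted A = leb A.
Proof.
pose g (k : nat) : set V := cball 0 k%:R.
apply: (measure_unique boxes g).
- exact: measurable_boxesE.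
- exact: boxes_setI.
- move=> k; exists (0 - const_mx k%:R), (0 + const_mx k%:R).
  by rewrite /g cballE.
- rewrite -subTset => x _; exists (Num.truncn `|x|).+1 => //.
  by rewrite /g /cball /= subr0 ltW// archimedean.Num.Theory.truncnS_gt.
- move=> _ [a [b ->]]; transitivity (leb (box (a - h) (b - h))).
    congr (leb _); apply/seteqP.
    by split => x /= xab i j; have := xab i j; rewrite !mxE; lra.
  have [/existsP[i /existsP[j ba]]|/existsPn ab] :=
    boolP [exists i, exists j, b i j < a i j].
    by rewrite !(@box_empty _ _ i j)// !mxE ltrD2r.
  have {}ab i j : a i j <= b i j.
    by have /existsPn/(_ j) := ab i; rewrite -leNgt.
  apply: etrans (lebesgue_mx_box _) (etrans _ (esym (lebesgue_mx_box ab))).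
    by move=> i j; rewrite !mxE lerD2r.
  congr EFin; apply: eq_bigr => i _; apply: eq_bigr => j _.
  by rewrite !mxE; ring.
- move=> k; suff : (leb (cball (- h) k%:R) < +oo)%E.
    congr (leb _ < _)%E; rewrite /g /cball; apply/seteqP.
    by split=> x /=; rewrite subr0 opprK.
  by apply: le_lt_trans (ltry _); rewrite (lebesgue_cball (- h) (ler0n _ k)).
Qed.

Let eq_shifted (f : V -> \bar R) :
  (\int[shifted]_x f x = \int[leb]_x f x)%E.
Proof. by apply: eq_measure_integral => A mA _; exact: lebesgue_mx_shift. Qed.

Lemma integrable_shift (f : V -> R) : leb.-integrable setT (EFin \o f) ->
  leb.-integrable setT (EFin \o (fun x => f (x + h))).
Proof.
move=> /integrableP[mf foo]; apply/integrableP; split.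
  exact: (measurableT_comp mf (measurable_shift h)).
rewrite (le_lt_trans _ foo)// -(eq_shifted (fun y => `|(f y)%:E|%E)).
rewrite (ge0_integral_pushforward (measurable_shift h))//.
exact: measurableT_comp.
Qed.

Lemma Rintegral_shift (f : V -> R) : leb.-integrable setT (EFin \o f) ->
  \int[leb]_x f (x + h) = \int[leb]_x f x.
Proof.
move=> fi; rewrite /Rintegral -(eq_shifted (fun x => (f x)%:E)).
rewrite (integral_pushforward (measurable_shift h))//.
- exact: measurable_int fi.
- exact: integrable_shift.
Qed.

End shift.

End mx_measure.

(** * Integrals bounded by dyadic layers *)

Section nonneg_integral.
Context d (T : measurableType d) {R : realType}.
Variable mu : {measure set T -> \bar R}.
Local Open Scope ereal_scope.

(** The integral of a nonnegative function is a supremum over the simple functions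
    below it. This form serves integrands whose measurability is not at hand, such
    as those of the multiplier. *)
Lemma ge0_integral_mono (D : set T) (f g : T -> \bar R) :
  (forall x, D x -> 0 <= f x) -> (forall x, D x -> f x <= g x) ->
  \int[mu]_(x in D) f x <= \int[mu]_(x in D) g x.
Proof.
move=> f0 fg; rewrite (integral_mkcond D f) (integral_mkcond D g).
have f0' x : 0 <= (f \_ D) x by apply: erestrict_ge0.
have fg' x : (f \_ D) x <= (g \_ D) x by exact: lee_restrict.
rewrite !ge0_integralTE//; last by move=> x; apply: le_trans (fg' x).
apply: ereal_sup_le => _ [h hf <-]; exists h => // x.
exact: le_trans (hf x) (fg' x).
Qed.

End nonneg_integral.

Lemma lee_prod_EFin (R : realType) (l : nat) (f : 'I_l -> \bar R) (b : 'I_l -> R) :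
  (forall j, 0 <= f j <= (b j)%:E)%E ->
  (0 <= \prod_j f j <= (\prod_j b j)%:E)%E.
Proof.
move=> fb; rewrite -prodEFin; elim/big_rec2 : _ => [|j y1 y2 _ /andP[y20 y21]].
  by rewrite lexx lee01.
have /andP[? ?] := fb j.
by rewrite mule_ge0//= lee_pmul.
Qed.

Lemma geometric_sum_le (R : realType) (q : R) N : 0 <= q < 1 ->
  \sum_(0 <= k < N) q ^+ k <= (1 - q)^-1.
Proof.
move=> /andP[q0 q1]; have q1' : 0 < 1 - q by lra.
rewrite -[leRHS]mul1r ler_pdivlMr// big_mkord mulrC -opprB mulNr.
by rewrite -subrX1 opprB lerBlDr lerDl exprn_ge0.
Qed.

Section mx_integral.
Context {R : realType} (m n : nat).
Local Notation V := 'M[R]_(m, n).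
Local Notation leb := (@lebesgue_mx R m n).

(** A discrete layer-cake bound, which replaces polar coordinates: with cubes of
    radius 2 ^ k it handles decay at infinity, with radius 2 ^ (- k) a pole. *)
Lemma integral_le_layers (D : set V) (g : V -> R) (c r : nat -> R) (a : V) (K q : R) :
  (forall k, 0 <= c k) -> (forall k, 0 <= r k) -> (forall x, D x -> 0 <= g x) ->
  (forall x, D x -> g x = 0 \/ exists k, g x <= c k /\ `|x - a| <= r k) ->
  0 <= q < 1 -> (forall k, c k * (2 * r k) ^+ (m * n) <= K * q ^+ k) ->
  (\int[leb]_(x in D) (g x)%:E <= (K / (1 - q))%:E)%E.
Proof.
move=> c0 r0 g0 gc q01 cK.
pose F k (x : V) := ((c k)%:E * (\1_(cball a (r k)) x)%:E)%E.
have F0 k x : (0 <= F k x)%E by rewrite mule_ge0 ?lee_fin.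
have mF k : measurable_fun setT (F k).
  apply: emeasurable_funM => //; apply/measurable_EFinP.
  by apply: measurable_indic; exact: measurable_cball.
apply: (@le_trans _ _ (\int[leb]_x (\sum_(k <oo) F k x))%E).
  rewrite integral_mkcond; apply: ge0_integral_mono => x _.
    by apply: erestrict_ge0 => ? ?; rewrite lee_fin; exact: g0.
  rewrite patchE; case: ifPn => [|_]; last by apply: nneseries_ge0.
  rewrite inE => Dx; have [->|[k [gk xk]]] := gc x Dx.
    by apply: nneseries_ge0.
  apply: (@le_trans _ _ (F k x)).
    by rewrite /F indicE mem_set// mule1 lee_fin.
  rewrite (@nneseriesD1 _ _ k)//.
  by rewrite leeDl// nneseries_ge0.
rewrite integral_nneseries//.
have iF k : (\int[leb]_x F k x)%E = (c k * (2 * r k) ^+ (m * n))%:E.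
  rewrite /F ge0_integralZl_EFin//; last first.
    by apply/measurable_EFinP; apply: measurable_indic; exact: measurable_cball.
  rewrite integral_indic ?setIT//; last exact: measurable_cball.
  by rewrite EFinM; congr (_ * _)%E; exact: lebesgue_cball.
under eq_eseriesr => k _ do rewrite iF.
apply: lime_le.
  by apply: is_cvg_nneseries => k _ _; rewrite lee_fin mulr_ge0// exprn_ge0// mulr_ge0.
apply: nearW => N; rewrite sumEFin lee_fin.
apply: (@le_trans _ _ (\sum_(0 <= k < N) K * q ^+ k)); first by apply: ler_sum.
have K0 : 0 <= K.
  by have := cK 0%N; rewrite expr0 mulr1; apply: le_trans; rewrite mulr_ge0// exprn_ge0// mulr_ge0.
by rewrite -mulr_sumr ler_wpM2l// geometric_sum_le.
Qed.

Lemma floor_log2 (t : R) : 1 <= t -> exists k : nat, 2 ^+ k <= t < 2 ^+ k.+1.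
Proof.
move=> t1; have [N tN] : exists N : nat, t < 2 ^+ N.
  exists (Num.truncn t).+1; apply: lt_trans (archimedean.Num.Theory.truncnS_gt t) _.
  by rewrite -natrX ltr_nat ltn_expl.
elim: N => [|N IH] in tN *; first by move: tN; rewrite expr0; lra.
by have [/IH//|NT] := ltP t (2 ^+ N); exists N; rewrite NT.
Qed.

(** The shell of radius 2 ^ k has volume of order 2 ^ (k d), against a weight of
    order 2 ^ (- 2 k d); the bound does not depend on the center. *)
Lemma integral_schwartz_weight (a : V) : (0 < m * n)%N ->
  (\int[leb]_x ((1 + `|x - a|) ^- (2 * (m * n)))%:E <= (2 * 4 ^+ (m * n))%:E)%E.
Proof.
set d := (m * n)%N => d0.
rewrite (_ : 2 * 4 ^+ d = 4 ^+ d / (1 - 2^-1)); last by field.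
apply: (@integral_le_layers _ _ (fun k => (2 ^+ k) ^- (2 * d)) (fun k => 2 ^+ k.+1) a).
- by move=> k; rewrite invr_ge0 !exprn_ge0.
- by move=> k; rewrite exprn_ge0.
- by move=> x _; rewrite invr_ge0 !exprn_ge0// addr_ge0.
- move=> x _; right; have [|k /andP[k1 k2]] := @floor_log2 (1 + `|x - a|).
    by rewrite lerDl.
  exists k; split; last by apply: le_trans (ltW k2); rewrite lerDr.
  by rewrite lef_pV2 ?posrE ?exprn_gt0// ?ltr_pwDl// lerXn2r ?nnegrE// addr_ge0.
- by lra.
- move=> k; have -> : (2 * 2 ^+ k.+1 : R) = 4 * 2 ^+ k by rewrite exprS; ring.
  have X0 : (2 ^+ k) ^+ d != 0 :> R by rewrite !expf_neq0.
  rewrite (mulnC 2%N) exprM expr2 exprMn.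
  rewrite (_ : _ * (_ * _) = 4 ^+ d * ((2 ^+ k) ^+ d)^-1); last by field.
  rewrite ler_wpM2l ?exprn_ge0// exprVn lef_pV2 ?posrE ?exprn_gt0//.
  by rewrite -exprM ler_weXn2l ?ler1n// -{1}(muln1 k) leq_mul2l d0 orbT.
Qed.

(** The dyadic shells around the pole contribute a geometric series because al is
    below the dimension; the power of r reflects the scaling of the integral. *)
Lemma integral_cball_powR (al : R) : 0 < al < (m * n)%:R ->
  exists2 K : R, 0 < K & forall (a : V) (r : R), 0 < r ->
    (\int[leb]_(x in cball a r) (`|x - a| `^ (- al))%:E <=
      (K * r `^ ((m * n)%:R - al))%:E)%E.
Proof.
set d := (m * n)%N => /andP[al0 ald].
pose q : R := 2 `^ (al - d%:R).
have q0 : 0 < q by rewrite powR_gt0.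
have q1 : q < 1 by rewrite /q /powR pnatr_eq0/= expR_lt1 pmulr_llt0 ?subr_lt0// ln_gt0// ltr1n.
exists (2 `^ al * 2 ^+ d / (1 - q)).
  by rewrite divr_gt0 ?mulr_gt0 ?powR_gt0 ?exprn_gt0 ?subr_gt0.
move=> a r r0; rewrite mulrAC.
have r2 k : 0 < r / 2 ^+ k by rewrite divr_gt0 ?exprn_gt0.
apply: (@integral_le_layers _ _ (fun k => (r / 2 ^+ k.+1) `^ (- al)) (fun k => r / 2 ^+ k) a).
- by move=> k; exact: powR_ge0.
- by move=> k; exact: ltW.
- by move=> x _; exact: powR_ge0.
- move=> x; rewrite /cball/= => xr; have [x0|xn0] := eqVneq `|x - a| 0.
    by left; rewrite x0 powR0// oppr_eq0 gt_eqF.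
  have x0 : 0 < `|x - a| by rewrite lt_neqAle eq_sym xn0 normr_ge0.
  have [|k /andP[k1 k2]] := @floor_log2 (r / `|x - a|).
    by rewrite ler_pdivlMr// mul1r.
  right; exists k; split.
    rewrite !powRN lef_pV2 ?posrE ?powR_gt0//.
    apply: ge0_ler_powR; rewrite ?nnegrE ?(ltW al0) ?(ltW (r2 _)) ?(ltW x0)//.
    by rewrite ler_pdivrMr ?exprn_gt0// mulrC -ler_pdivrMr// ltW.
  by rewrite ler_pdivlMr ?exprn_gt0// mulrC -ler_pdivlMr.
- by rewrite q1 ltW.
- move=> k; rewrite le_eqVlt; apply/orP; left; apply/eqP.
  have two0 : (2 : R) != 0 by [].
  have -> : q = 2 `^ al / 2 ^+ d.
    by rewrite /q powRD ?two0 ?implybT// powRN powR_mulrn.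
  have -> : (r / 2 ^+ k.+1) `^ (- al) = r `^ (- al) * (2 `^ al * (2 `^ al) ^+ k).
    rewrite powRM ?invr_ge0 ?exprn_ge0 ?(ltW r0)//; congr (_ * _).
    rewrite -exprS -!powR_mulrn ?powR_ge0// -powRN -!powRrM.
    by rewrite mulrNN mulrC.
  have -> : r `^ (d%:R - al) = r `^ (- al) * r ^+ d.
    by rewrite powRD ?(gt_eqF r0) ?implybT// powR_mulrn ?(ltW r0)// mulrC.
  rewrite !exprMn !exprVn -!exprM (mulnC d k).
  by ring.
Qed.

End mx_integral.

(** * Complex-valued integrals *)

Lemma lipschitz_is_derive (R : realType) (f df : R -> R) (C : R) :
  (forall x : R, is_derive x 1 f (df x)) -> (forall x, `|df x| <= C) ->
  forall x y, `|f y - f x| <= C * `|y - x|.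
Proof.
move=> fd dfC; suff H x y : x <= y -> `|f y - f x| <= C * `|y - x|.
  by move=> x y; have [/H//|/ltW/H] := leP x y; rewrite distrC (distrC x).
move=> xy; have [|c _ ->] := MVT_segment xy (fun z _ => fd z).
  apply: derivable_within_continuous => z _.
  by have [] := fd z.
by rewrite normrM ler_wpM2r.
Qed.

Section complex_norm.
Context {R : realType}.
Implicit Types z : R[i].
Local Notation normc := (@Normc.normc R).

Lemma normc_ge0 z : 0 <= normc z.
Proof. by case: z => a b; exact: sqrtr_ge0. Qed.

Lemma Re_le_normc z : `|complex.Re z| <= normc z.
Proof.
case: z => a b /=; rewrite -sqrtr_sqr ler_sqrt ?lerDl ?sqr_ge0//.
by rewrite addr_ge0 ?sqr_ge0.
Qed.

Lemma Im_le_normc z : `|complex.Im z| <= normc z.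
Proof.
case: z => a b /=; rewrite -sqrtr_sqr ler_sqrt ?lerDr ?sqr_ge0//.
by rewrite addr_ge0 ?sqr_ge0.
Qed.

Lemma normc_le_ReIm z : normc z <= `|complex.Re z| + `|complex.Im z|.
Proof.
case: z => a b /=; rewrite -[leRHS]ger0_norm ?addr_ge0// -sqrtr_sqr.
rewrite ler_sqrt ?sqr_ge0// sqrrD !real_normK ?num_real// -addrA lerD2l.
by rewrite addrC lerDl mulrn_wge0 ?mulr_ge0.
Qed.

Lemma normc_real (x : R) : normc x%:C = `|x|.
Proof. by rewrite /= expr0n addr0 sqrtr_sqr. Qed.

Lemma normcX z k : normc (z ^+ k) = normc z ^+ k.
Proof. by elim: k => [|k IH]; rewrite ?Normc.normc1// !exprS Normc.normcM IH. Qed.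

Lemma ReM z1 z2 : complex.Re (z1 * z2) =
  complex.Re z1 * complex.Re z2 - complex.Im z1 * complex.Im z2.
Proof. by case: z1; case: z2. Qed.

Lemma ImM z1 z2 : complex.Im (z1 * z2) =
  complex.Re z1 * complex.Im z2 + complex.Im z1 * complex.Re z2.
Proof. by case: z1; case: z2. Qed.

Lemma expiD (s t : R) : expi (s + t) = expi s * expi t.
Proof.
by apply/eqP; rewrite eq_complex ReM ImM /= cosD sinD [X in _ && (_ == X)]addrC !eqxx.
Qed.

Lemma normc_expi (t : R) : normc (expi t) = 1.
Proof. by rewrite /= cos2Dsin2 sqrtr1. Qed.

Lemma normc_expi_sub1 (t : R) : normc (expi t - 1) <= 2 * `|t|.
Proof.
have lip (f df : R -> R) : (forall x : R, is_derive x 1 f (df x)) ->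
    (forall x, `|df x| <= 1) -> `|f t - f 0| <= `|t|.
  by move=> fd df1; have := lipschitz_is_derive fd df1 0 t; rewrite subr0 mul1r.
apply: le_trans (normc_le_ReIm _) _; rewrite mulr_natl mulr2n lerD//=.
  rewrite -cos0; apply: (lip cos (fun x => - sin x)) => x.
  by rewrite normrN sin_max.
rewrite subr0 -(subr0 (sin t)) -sin0; apply: (lip sin cos) => x.
exact: cos_max.
Qed.

End complex_norm.

Section cintegral.
Context {R : realType} (m n : nat).
Local Notation V := 'M[R]_(m, n).
Local Notation leb := (@lebesgue_mx R m n).
Local Notation normc := (@Normc.normc R).
Implicit Types f g : V -> R[i].

Definition cmeasurable f :=
  measurable_fun setT (fun x => complex.Re (f x)) /\
  measurable_fun setT (fun x => complex.Im (f x)).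

Definition cintegrable f :=
  leb.-integrable setT (EFin \o (fun x => complex.Re (f x))) /\
  leb.-integrable setT (EFin \o (fun x => complex.Im (f x))).

Lemma cmeasurableM f g : cmeasurable f -> cmeasurable g ->
  cmeasurable (fun x => f x * g x).
Proof.
move=> [f1 f2] [g1 g2]; split.
  by under eq_fun do rewrite ReM; apply: measurable_funB; exact: measurable_funM.
by under eq_fun do rewrite ImM; apply: measurable_funD; exact: measurable_funM.
Qed.

Lemma cmeasurableB f g : cmeasurable f -> cmeasurable g ->
  cmeasurable (fun x => f x - g x).
Proof.
move=> [f1 f2] [g1 g2]; split => /=; under eq_fun do rewrite raddfB/=;
  exact: measurable_funB.
Qed.

Lemma cmeasurable_real (f : V -> R) : measurable_fun setT f ->
  cmeasurable (fun x => (f x)%:C).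
Proof. by split => //=; exact: measurable_cst. Qed.

Lemma cmeasurable_cst (c : R[i]) : cmeasurable (fun=> c).
Proof. by split; exact: measurable_cst. Qed.

Lemma measurable_dot (y : V) : measurable_fun setT (fun x : V => dot x y).
Proof.
apply: measurable_sum => i; apply: measurable_sum => j.
by apply: measurable_funM => //; exact: measurable_entry.
Qed.

Lemma cmeasurable_expi (f : V -> R) : measurable_fun setT f ->
  cmeasurable (fun x => expi (f x)).
Proof.
move=> mf; split => /=.
  by apply: measurableT_comp mf; apply: continuous_measurable_fun; exact: continuous_cos.
by apply: measurableT_comp mf; apply: continuous_measurable_fun; exact: continuous_sin.
Qed.

Lemma cmeasurable_shift f (h : V) : cmeasurable f -> cmeasurable (fun x => f (x + h)).
Proof.
move=> [f1 f2]; split; first exact: (measurableT_comp f1 (measurable_shift h)).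
exact: (measurableT_comp f2 (measurable_shift h)).
Qed.

Lemma cintegrable_measurable f : cintegrable f -> cmeasurable f.
Proof.
by move=> [/measurable_int/measurable_EFinP ? /measurable_int/measurable_EFinP].
Qed.

Lemma cintegrable_le f (g : V -> R) : cmeasurable f ->
  (forall x, normc (f x) <= g x) -> (\int[leb]_x (g x)%:E < +oo)%E ->
  cintegrable f.
Proof.
move=> [f1 f2] fg goo.
split; apply/integrableP; split; try exact/measurable_EFinP;
  apply: le_lt_trans goo; apply: ge0_integral_mono => x _ //=;
  rewrite lee_fin; apply: le_trans (fg x).
- exact: Re_le_normc.
- exact: Im_le_normc.
Qed.

Lemma cintegrable_normc f : cintegrable f ->
  (\int[leb]_x (normc (f x))%:E < +oo)%E.
Proof.
move=> [/integrable_norm/= fi1 /integrable_norm/= fi2].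
have /integrableP[_ goo] := integrableD measurableT fi1 fi2.
apply: le_lt_trans goo; apply: ge0_integral_mono => x _.
  by rewrite lee_fin normc_ge0.
by rewrite /= lee_fin (le_trans (normc_le_ReIm _))// ler_norm.
Qed.

Lemma normc_cintegral_le f (g : V -> R) (K : R) : cmeasurable f ->
  (forall x, normc (f x) <= g x) -> (\int[leb]_x (g x)%:E <= K%:E)%E ->
  normc (cintegral f) <= 2 * K.
Proof.
move=> mf fg gK.
have [fi1 fi2] := cintegrable_le mf fg (le_lt_trans gK (ltry K)).
apply: le_trans (normc_le_ReIm _) _; rewrite mulr_natl mulr2n /=.
apply: lerD; rewrite -lee_fin; apply: le_trans gK.
- rewrite EFin_normr_Rintegral//; apply: le_trans (le_abse_integral _ _ _) _ => //.
    exact: measurable_int fi1.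
  apply: ge0_integral_mono => x _ //=.
  by rewrite lee_fin; apply: le_trans (Re_le_normc _) (fg x).
- rewrite EFin_normr_Rintegral//; apply: le_trans (le_abse_integral _ _ _) _ => //.
    exact: measurable_int fi2.
  apply: ge0_integral_mono => x _ //=.
  by rewrite lee_fin; apply: le_trans (Im_le_normc _) (fg x).
Qed.

Lemma cintegralZ (c : R[i]) f : cintegrable f ->
  cintegral (fun x => c * f x) = c * cintegral f.
Proof.
case: c => a b [fi1 fi2]; rewrite /cintegral.
have Z (r : R) (h : V -> R) : leb.-integrable setT (EFin \o h) ->
    leb.-integrable setT (EFin \o (fun x => r * h x)).
  by move=> hi; exact: (integrableZl measurableT r hi).
under eq_Rintegral do rewrite ReM.
under [X in _ +i* X]eq_Rintegral do rewrite ImM.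
rewrite /= RintegralB ?RintegralD ?RintegralZl//; try exact: Z.
Qed.

Lemma cintegralB f g : cintegrable f -> cintegrable g ->
  cintegral (fun x => f x - g x) = cintegral f - cintegral g.
Proof.
move=> [f1 f2] [g1 g2]; rewrite /cintegral.
under eq_Rintegral do rewrite raddfB/=.
under [X in _ +i* X]eq_Rintegral do rewrite raddfB/=.
by rewrite /= !RintegralB.
Qed.

Lemma cintegral_shift f (h : V) : cintegrable f ->
  cintegral (fun x => f (x + h)) = cintegral f.
Proof.
move=> [f1 f2]; rewrite /cintegral (Rintegral_shift h f1).
by rewrite (Rintegral_shift h f2).
Qed.

Lemma cintegrable_shift f (h : V) : cintegrable f -> cintegrable (fun x => f (x + h)).
Proof. by move=> [f1 f2]; split; [exact: integrable_shift f1|exact: integrable_shift f2]. Qed.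

Lemma cintegrableB f g : cintegrable f -> cintegrable g ->
  cintegrable (fun x => f x - g x).
Proof.
move=> [f1 f2] [g1 g2]; split.
  under [X in integrable _ _ X]eq_fun do rewrite /= raddfB/= EFinB.
  exact: integrableB.
under [X in integrable _ _ X]eq_fun do rewrite /= raddfB/= EFinB.
exact: integrableB.
Qed.

Lemma cintegrableM f g : cintegrable f -> cmeasurable g ->
  (forall x, normc (g x) = 1) -> cintegrable (fun x => f x * g x).
Proof.
move=> fi mg g1.
apply: cintegrable_le (cintegrable_normc fi).
  by apply: cmeasurableM => //; exact: cintegrable_measurable.
by move=> x; rewrite Normc.normcM g1 mulr1.
Qed.

End cintegral.

(** * Finite differences and decay of Fourier transforms *)

Section finite_difference.
Context {V W : zmodType}.
Implicit Types (h : V) (f g : V -> W).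

Definition fdiff h f : V -> W := fun x => f (x + h) - f x.

Lemma iter_fdiffD h f g k :
  iter k (fdiff h) (fun x => f x + g x) =
  (fun x => iter k (fdiff h) f x + iter k (fdiff h) g x).
Proof.
elim: k => // k /= ->; apply/funext => x.
by rewrite /fdiff opprD addrACA.
Qed.

Lemma iter_fdiff_shift h f k a :
  iter k (fdiff h) (fun x => f (x + a)) = (fun x => iter k (fdiff h) f (x + a)).
Proof.
by elim: k => // k /= ->; apply/funext => x; rewrite /fdiff addrAC.
Qed.

End finite_difference.

Section difference_product.
Context {R : realType} {V : zmodType}.
Local Notation normc := (@Normc.normc R).

(** Leibniz rule for finite differences, as an estimate: the difference of a
    product is a sum of products in which one factor is translated. *)
Lemma normc_iter_fdiffM (h : V) (t : R) (M : nat) (f g : V -> R[i]) (A B : R) :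
  (forall k x, (k <= M)%N -> normc (iter k (fdiff h) f x) <= A * t ^+ k) ->
  (forall k x, (k <= M)%N -> normc (iter k (fdiff h) g x) <= B * t ^+ k) ->
  forall x, normc (iter M (fdiff h) (fun x => f x * g x) x) <=
    2 ^+ M * (A * B) * t ^+ M.
Proof.
elim: M => [|M IH] in f g A B * => fA gB x.
  have := fA 0%N x erefl; have := gB 0%N x erefl.
  rewrite !expr0 !mulr1 mul1r /= => fx gx.
  by rewrite Normc.normcM ler_pM// normc_ge0.
rewrite iterSr.
have -> : fdiff h (fun x => f x * g x) =
    (fun x => f (x + h) * fdiff h g x + fdiff h f x * g x).
  by apply/funext => y; rewrite /fdiff; ring.
rewrite iter_fdiffD; apply: le_trans (le_normcD _ _) _.
have -> : 2 ^+ M.+1 * (A * B) * t ^+ M.+1 =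
   2 ^+ M * (A * (B * t)) * t ^+ M + 2 ^+ M * ((A * t) * B) * t ^+ M.
  by rewrite !exprS; ring.
apply: lerD.
- apply: (IH (fun x => f (x + h)) (fdiff h g)) => k y kM.
    by rewrite iter_fdiff_shift; apply: fA; exact: leqW.
  by rewrite -iterSr -mulrA -exprS; exact: gB.
- apply: (IH (fdiff h f) g) => k y kM.
    by rewrite -iterSr -mulrA -exprS; exact: fA.
  by apply: gB; exact: leqW.
Qed.

End difference_product.

Section fourier_difference.
Context {R : realType} (m n : nat).
Local Notation V := 'M[R]_(m, n).
Local Notation leb := (@lebesgue_mx R m n).
Local Notation normc := (@Normc.normc R).
Implicit Types f : V -> R[i].

Lemma dotDl (x y z : V) : dot (x + y) z = dot x z + dot y z.
Proof.
rewrite /dot -big_split/=; apply: eq_bigr => i _; rewrite -big_split/=.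
by apply: eq_bigr => j _; rewrite mxE mulrDl.
Qed.

Lemma dotC (x y : V) : dot x y = dot y x.
Proof. by apply: eq_bigr => i _; apply: eq_bigr => j _; rewrite mulrC. Qed.

Lemma dotZl c (x y : V) : dot (c *: x) y = c * dot x y.
Proof.
rewrite /dot mulr_sumr; apply: eq_bigr => i _; rewrite mulr_sumr.
by apply: eq_bigr => j _; rewrite mxE mulrA.
Qed.

Lemma dot_delta i j (x : V) : dot (delta_mx i j) x = x i j.
Proof.
rewrite /dot (bigD1 i)//= (bigD1 j)//= mxE !eqxx mul1r.
rewrite big1 => [|j' /negPf jj']; last by rewrite mxE jj' andbF mul0r.
rewrite big1 ?addr0// => i' /negPf ii'; rewrite big1// => j' _.
by rewrite mxE ii' mul0r.
Qed.

Lemma normr_dot (x y : V) : `|dot x y| <= (m * n)%:R * (`|x| * `|y|).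
Proof.
have -> : (m * n)%:R * (`|x| * `|y|) = \sum_(i < m) \sum_(j < n) `|x| * `|y|.
  by rewrite !sumr_const !card_ord -mulrnA mulr_natl mulnC.
apply: le_trans (ler_norm_sum _ _ _) _; apply: ler_sum => i _.
apply: le_trans (ler_norm_sum _ _ _) _; apply: ler_sum => j _.
by rewrite normrM ler_pM// entry_le_norm.
Qed.

Lemma cmeasurable_kernel (x : V) : cmeasurable (fun y : V => expi (- (2 * pi * dot y x))).
Proof.
apply: cmeasurable_expi; apply: measurableT_comp => //.
by apply: measurable_funM => //; exact: measurable_dot.
Qed.

Lemma cintegrable_fourier f (x : V) : cintegrable f ->
  cintegrable (fun y => f y * expi (- (2 * pi * dot y x))).
Proof.
move=> fi; apply: cintegrableM => //; first exact: cmeasurable_kernel.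
by move=> y; exact: normc_expi.
Qed.

(** Translating the argument multiplies the Fourier transform by a character. *)
Lemma fourier_fdiff f (h x : V) : cintegrable f ->
  fourier (fdiff h f) x = (expi (2 * pi * dot h x) - 1) * fourier f x.
Proof.
move=> fi; rewrite mulrBl mul1r /fourier.
rewrite -{1}(cintegral_shift h (cintegrable_fourier x fi)).
rewrite -cintegralZ; last exact: cintegrable_shift h (cintegrable_fourier x fi).
rewrite -cintegralB; last 2 first.
- have : cintegrable (fun y => (f (y + h) * expi (- (2 * pi * dot y x)))).
    by apply: cintegrable_fourier; exact: cintegrable_shift.
  congr cintegrable; apply/funext => y.
  rewrite mulrCA -expiD dotDl; congr (_ * expi _); ring.
- exact: cintegrable_fourier.
congr cintegral; apply/funext => y; rewrite /fdiff mulrBl; congr (_ - _).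
by rewrite mulrCA -expiD dotDl; congr (_ * expi _); ring.
Qed.

Lemma cmeasurable_iter_fdiff f h k : cmeasurable f -> cmeasurable (iter k (fdiff h) f).
Proof.
move=> mf; elim: k => //= k IH; apply: cmeasurableB => //.
exact: cmeasurable_shift.
Qed.

Lemma cintegrable_iter_fdiff f h k : cintegrable f -> cintegrable (iter k (fdiff h) f).
Proof.
move=> mf; elim: k => //= k IH; apply: cintegrableB => //.
exact: cintegrable_shift.
Qed.

Lemma fourier_iter_fdiff f (h x : V) k : cintegrable f ->
  fourier (iter k (fdiff h) f) x = (expi (2 * pi * dot h x) - 1) ^+ k * fourier f x.
Proof.
move=> fi; elim: k => [|k IH]; first by rewrite mul1r.
by rewrite iterS fourier_fdiff ?IH ?exprS ?mulrA//; exact: cintegrable_iter_fdiff.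
Qed.

Lemma integral_cball_cst (r A : R) : 0 <= r -> 0 <= A ->
  (\int[leb]_x (A * \1_(cball 0 r) x)%:E)%E = (A * (2 * r) ^+ (m * n))%:E.
Proof.
move=> r0 A0; under eq_integral do rewrite EFinM.
rewrite ge0_integralZl_EFin//; last first.
  by apply/measurable_EFinP; apply: measurable_indic; exact: measurable_cball.
rewrite integral_indic ?setIT//; last exact: measurable_cball.
by rewrite EFinM; congr (_ * _)%E; exact: lebesgue_cball.
Qed.

Lemma normc_le_indic f (r A : R) : (forall x, normc (f x) <= A) ->
  (forall x, r < `|x| -> f x = 0) ->
  forall x, normc (f x) <= A * \1_(cball 0 r) x.
Proof.
move=> fA f0 x; rewrite indicE; have [xr|xr] := leP `|x| r.
  by rewrite mem_set ?mulr1//; rewrite /cball /= subr0.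
by rewrite memNset ?mulr0 ?f0 ?Normc.normc0// /cball/= subr0; apply/negP; rewrite -ltNge.
Qed.

Lemma cintegrable_bounded_support f (r A : R) : cmeasurable f -> 0 <= r ->
  (forall x, normc (f x) <= A) -> (forall x, r < `|x| -> f x = 0) -> cintegrable f.
Proof.
move=> mf r0 fA f0; have A0 : 0 <= A by apply: le_trans (fA 0); exact: normc_ge0.
apply: (cintegrable_le mf (normc_le_indic fA f0)).
by rewrite integral_cball_cst// ltry.
Qed.

Lemma normc_fourier_le f (r A : R) (x : V) : cmeasurable f -> 0 <= r ->
  (forall x, normc (f x) <= A) -> (forall x, r < `|x| -> f x = 0) ->
  normc (fourier f x) <= 2 * (A * (2 * r) ^+ (m * n)).
Proof.
move=> mf r0 fA f0; have A0 : 0 <= A by apply: le_trans (fA 0); exact: normc_ge0.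
apply: (@normc_cintegral_le _ _ _ _ (fun x => A * \1_(cball 0 r) x)).
- by apply: cmeasurableM => //; exact: cmeasurable_kernel.
- by move=> y; rewrite Normc.normcM normc_expi mulr1 normc_le_indic.
- by rewrite integral_cball_cst.
Qed.

Lemma iter_fdiff_support f (h : V) (r : R) k :
  (forall x, r < `|x| -> f x = 0) ->
  forall x, r + k%:R * `|h| < `|x| -> iter k (fdiff h) f x = 0.
Proof.
move=> f0; elim: k => [|k IH] x; first by rewrite mul0r addr0; exact: f0.
rewrite -natr1 mulrDl mul1r addrA => xr /=; rewrite /fdiff !IH ?subrr//.
  by apply: le_lt_trans xr; rewrite lerDl.
have : `|x| <= `|x + h| + `|h| by rewrite -{1}(addrK h x); exact: ler_normB.
by move: xr; lra.
Qed.

(** Smoothness gives decay, with differences in place of derivatives: in the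
    direction of the largest coordinate t of the frequency, the step 1 / (2 t)
    makes the character in the difference formula equal to -1. *)
Lemma fourier_decay f (M : nat) (A r : R) : cmeasurable f -> 0 <= r ->
  (forall x, r < `|x| -> f x = 0) ->
  (forall x, normc (f x) <= A) ->
  (forall i j eta x, 0 <= eta ->
     normc (iter M (fdiff (eta *: delta_mx i j)) f x) <= A * eta ^+ M) ->
  forall x, normc (fourier f x) <=
    2 ^+ M * 2 * (2 * (r + M%:R)) ^+ (m * n) * A * (1 + `|x|) ^- M.
Proof.
move=> mf r0 f0 fA fAM x.
have A0 : 0 <= A by apply: le_trans (fA 0); exact: normc_ge0.
have fi : cintegrable f by exact: (cintegrable_bounded_support mf r0 fA f0).
have rM : 0 <= r + M%:R by rewrite addr_ge0.
have x1 : 0 < 1 + `|x| by rewrite ltr_pwDl.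
have [xlt1|xge1] := ltP `|x| 1.
  apply: le_trans (normc_fourier_le x mf r0 fA f0) _.
  have -> : 2 ^+ M * 2 * (2 * (r + M%:R)) ^+ (m * n) * A * (1 + `|x|) ^- M =
      2 * (A * (2 * (r + M%:R)) ^+ (m * n)) * (2 / (1 + `|x|)) ^+ M.
    by rewrite expr_div_n; ring.
  apply: (@le_trans _ _ (2 * (A * (2 * (r + M%:R)) ^+ (m * n)))).
    rewrite ler_wpM2l// ler_wpM2l// lerXn2r ?nnegrE ?mulr_ge0//.
    by rewrite ler_wpM2l// lerDl.
  rewrite ler_peMr ?mulr_ge0 ?exprn_ge0 ?mulr_ge0//.
  by rewrite exprn_ege1// ler_pdivlMr// mul1r; lra.
have x0 : 0 < `|x| by exact: lt_le_trans xge1.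
have /(@mx_norm_neq0 _ _ _ _)[[i j] /= xE] : mx_norm x != 0 by exact: lt0r_neq0.
have {}xE : `|x| = `|x i j| by [].
pose eta := (2 * `|x|)^-1; have eta0 : 0 < eta by rewrite invr_gt0 mulr_gt0.
pose h := eta *: (delta_mx i j : V).
have hle : `|h| <= 1.
  apply: mx_norm_le => // i' j'; rewrite !mxE normrM gtr0_norm//.
  apply: (@le_trans _ _ (eta * 1)).
    by rewrite ler_wpM2l ?(ltW eta0)//; case: (_ && _); rewrite ?normr0 ?normr1 ?ler01.
  by rewrite mulr1 /eta invf_le1 ?mulr_gt0//; lra.
have hx : expi (2 * pi * dot h x) = -1 :> R[i].
  have xn0 : x i j != 0 by rewrite -normr_eq0 -xE gt_eqF.
  rewrite dotZl dot_delta /eta xE.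
  have [xij|xij] := leP 0 (x i j).
    have -> : 2 * pi * ((2 * `|x i j|)^-1 * x i j) = pi by rewrite ger0_norm//; field.
    by rewrite /expi cospi sinpi; apply/eqP; rewrite eq_complex/= oppr0 !eqxx.
  have -> : 2 * pi * ((2 * `|x i j|)^-1 * x i j) = - pi.
    by rewrite ltr0_norm//; field.
  rewrite /expi cosN sinN cospi sinpi; apply/eqP.
  by rewrite eq_complex/= oppr0 !eqxx.
have : normc (fourier (iter M (fdiff h) f) x) <=
    2 * (A * eta ^+ M * (2 * (r + M%:R)) ^+ (m * n)).
  apply: normc_fourier_le => //.
  - exact: cmeasurable_iter_fdiff.
  - by move=> y; apply: fAM; exact: ltW.
  - move=> y yr; apply: (iter_fdiff_support f0); apply: le_lt_trans yr.
    by rewrite lerD2l -[leRHS]mulr1 ler_wpM2l.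
rewrite fourier_iter_fdiff// hx Normc.normcM normcX.
have -> : normc (-1 - 1 : R[i]) = 2.
  have -> : -1 - 1 = (- 2 : R)%:C.
    by apply/eqP; rewrite eq_complex/=; apply/andP; split; apply/eqP; ring.
  by rewrite normc_real normrN ger0_norm.
rewrite -ler_pdivlMl ?exprn_gt0// => /le_trans; apply.
rewrite [leLHS](_ : _ = 2 * (A * (2 * (r + M%:R)) ^+ (m * n)) * (eta / 2) ^+ M); last first.
  by rewrite expr_div_n; ring.
rewrite [leRHS](_ : _ = 2 * (A * (2 * (r + M%:R)) ^+ (m * n)) * (2 / (1 + `|x|)) ^+ M); last first.
  by rewrite expr_div_n; ring.
rewrite ler_wpM2l ?mulr_ge0 ?exprn_ge0 ?mulr_ge0//.
rewrite lerXn2r ?nnegrE ?divr_ge0 ?(ltW x1) ?(ltW eta0)//.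
rewrite /eta ler_pdivrMr// mulrAC ler_pdivlMr// mulrC ler_pdivrMr ?mulr_gt0//.
by lra.
Qed.

End fourier_difference.

(** * Flat functions and bumps on the line *)

Section bump.
Context {R : realType}.
Implicit Types (t : R) (k a b : nat).

(** The classical flat function exp (- 1 / t) and its multiples by powers of
    1 / t; their linear span is stable under differentiation. *)
Definition flat k t : R := if 0 < t then (t^-1) ^+ k * expR (- t^-1) else 0.

Lemma flat_ge0 k t : 0 <= flat k t.
Proof.
rewrite /flat; case: ifP => // t0.
by rewrite mulr_ge0 ?expR_ge0// exprn_ge0// invr_ge0 ltW.
Qed.

Lemma flat_le k t : flat k t <= k`!%:R.
Proof.
rewrite /flat; case: ifP => // t0; have y0 : 0 <= t^-1 by rewrite invr_ge0 ltW.
rewrite expRN ler_pdivrMr ?expR_gt0//.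
case: k => [|k]; first by rewrite expr0 fact0 mul1r -expR0 ler_expR.
have := expR_ge1Dxn k y0; rewrite -ler_pdivrMl ?ltr0n ?fact_gt0//.
by move=> H; rewrite mulrC; apply: le_trans H; rewrite lerDr.
Qed.

Lemma flatS k t : flat k t = t * flat k.+1 t.
Proof.
rewrite /flat; case: ifP => t0; last by rewrite mulr0.
by rewrite exprS !mulrA mulfV ?mul1r// gt_eqF.
Qed.

Lemma is_derive_flat k t : is_derive t 1 (flat k) (flat k.+2 t - k%:R * flat k.+1 t).
Proof.
have [t0|t0|->] := ltgtP t 0.
- have -> : flat k.+2 t - k%:R * flat k.+1 t = 0.
    by rewrite /flat ltNge (ltW t0)/= mulr0 subr0.
  apply: (@near_eq_is_derive _ _ _ (cst 0)).
  near=> s; rewrite /flat ifF//; apply/negbTE; rewrite -leNgt ltW//.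
  by near: s; exact: lt_nbhsl.
- pose h (y : R) : R := y ^+ k * expR (- y).
  apply: (@near_eq_is_derive _ _ _ (h \o (fun s => s^-1))).
    near=> s; rewrite /flat ifT//.
    by near: s; exact: lt_nbhsr.
  have dV : is_derive t 1 (fun s : R => s^-1) (- (t ^- 2)).
    have := @is_deriveV R id t 1 1; rewrite gt_eqF// => /(_ isT (is_derive_id _ _)).
    by rewrite [_ *: _]mulr1.
  have dh : is_derive t^-1 1 h
     (k%:R * (t^-1) ^+ k.-1 * expR (- t^-1) - (t^-1) ^+ k * expR (- t^-1)).
    have dE : is_derive t^-1 1 (expR \o -%R) (expR (- t^-1) * -1).
      exact: is_derive1_comp.
    have D := is_deriveM (is_deriveX k (is_derive_id t^-1 (1 : R))) dE.
    have hE : (@id R) ^+ k * (expR \o -%R) = h.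
      by apply/funext => y; rewrite /h !fctE.
    rewrite hE in D; apply: (is_derive_eq D).
    by rewrite !fctE /GRing.scale/=; ring.
  apply: (is_derive_eq (is_derive1_comp dh dV)).
  rewrite /flat t0 -exprVn; case: k {h dh} => [|k] /=; rewrite ?mul0r ?mulr0n !exprS ?expr0; ring.
- have -> : flat k.+2 0 - k%:R * flat k.+1 0 = 0 by rewrite /flat ltxx mulr0 subr0.
  apply/is_derive1_caratheodory; exists (flat k.+1); split.
  + by move=> z; rewrite {2}/flat ltxx !subr0 mulrC; exact: flatS.
  + apply/cvgrPdist_le => /= e e0; near=> z.
    rewrite {1}/flat ltxx sub0r normrN flatS normrM (ger0_norm (flat_ge0 _ _)).
    apply: (@le_trans _ _ (`|z| * (k.+2)`!%:R)); first by rewrite ler_wpM2l// flat_le.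
    rewrite -ler_pdivlMr ?ltr0n ?fact_gt0//.
    near: z; exists (e / (k.+2)`!%:R) => [|z] /=.
      by rewrite divr_gt0// ltr0n fact_gt0.
    by rewrite sub0r normrN => /ltW.
  + by rewrite /flat ltxx.
Unshelve. all: by end_near. Qed.

Definition bump a b t : R := flat a t * flat b (1 - t).

Definition dbump a b t : R :=
  bump a.+2 b t - a%:R * bump a.+1 b t - bump a b.+2 t + b%:R * bump a b.+1 t.

Lemma is_derive_bump a b t : is_derive t 1 (bump a b) (dbump a b t).
Proof.
have dB : is_derive t 1 (fun s : R => 1 - s) (-1).
  have := is_deriveB (is_derive_cst (1 : R) t 1) (is_derive_id t 1).
  by rewrite sub0r.
have dc := @is_derive1_comp _ (flat b) (fun s => 1 - s) t _ _
  (is_derive_flat b (1 - t)) dB.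
apply: (is_derive_eq (is_deriveM (is_derive_flat a t) dc)).
by rewrite /dbump /bump /GRing.scale/=; ring.
Qed.

Lemma bump_ge0 a b t : 0 <= bump a b t.
Proof. by rewrite mulr_ge0// flat_ge0. Qed.

Lemma bump_le a b t : bump a b t <= a`!%:R * b`!%:R.
Proof. by rewrite ler_pM// ?flat_ge0// flat_le. Qed.

Lemma bump_le1 t : bump 0 0 t <= 1.
Proof. by have := bump_le 0 0 t; rewrite fact0 mulr1. Qed.

Lemma bump_eq0 a b t : ~~ (0 < t < 1) -> bump a b t = 0.
Proof.
rewrite negb_and -!leNgt /bump /flat => /orP[t0|t1].
  by rewrite ltNge t0 mul0r.
by rewrite subr_gt0 (ltNge t 1) t1 mulr0.
Qed.

Lemma bump_lower t : 4^-1 <= t <= 3 / 4 -> expR (- 8) <= bump 0 0 t.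
Proof.
move=> /andP[t1 t2]; rewrite /bump /flat !ifT; try lra.
rewrite !expr0 !mul1r -expRD ler_expR -opprD lerN2.
rewrite (_ : 8 = 4 + 4 :> R); last ring.
by rewrite lerD// -[leRHS]invrK lef_pV2 ?posrE; lra.
Qed.

Lemma is_derive_iter_fdiff (f df : R -> R) (h : R) k :
  (forall t, is_derive t 1 f (df t)) ->
  forall t, is_derive t 1 (iter k (fdiff h) f) (iter k (fdiff h) df t).
Proof.
move=> fd; elim: k => // k IH t /=; rewrite /fdiff.
have := @is_derive1_comp _ (iter k (fdiff h) f) (shift h) t _ _
  (IH (t + h)) (is_derive_shift t 1 h); rewrite mulr1 => d1.
exact: is_deriveB d1 (IH t).
Qed.

Lemma iter_fdiffZ (c : R) (f : R -> R) (h : R) k :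
  iter k (fdiff h) (fun x => c * f x) = (fun x => c * iter k (fdiff h) f x).
Proof. by elim: k => // k /= ->; apply/funext => x; rewrite /fdiff mulrBr. Qed.

(** Each difference of a smooth function costs one derivative, by the mean value
    theorem; all derivatives of a bump are combinations of bumps. *)
Lemma iter_fdiff_bump M : forall a b, exists2 C : R, 0 <= C &
  forall h t, `|iter M (fdiff h) (bump a b) t| <= C * `|h| ^+ M.
Proof.
elim: M => [|M IH] a b.
  exists (a`!%:R * b`!%:R) => // h t; rewrite expr0 mulr1 /=.
  by rewrite ger0_norm ?bump_ge0// bump_le.
have [C1 C10 H1] := IH a.+2 b; have [C2 C20 H2] := IH a.+1 b.
have [C3 C30 H3] := IH a b.+2; have [C4 C40 H4] := IH a b.+1.
exists (C1 + a%:R * C2 + C3 + b%:R * C4) => [|h t].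
  by rewrite !addr_ge0// mulr_ge0.
have H s : `|iter M (fdiff h) (dbump a b) s| <=
    (C1 + a%:R * C2 + C3 + b%:R * C4) * `|h| ^+ M.
  have -> : dbump a b = (fun s => bump a.+2 b s + (- a%:R) * bump a.+1 b s
      + (-1) * bump a b.+2 s + b%:R * bump a b.+1 s).
    by apply/funext => s'; rewrite /dbump; ring.
  rewrite 3!iter_fdiffD !iter_fdiffZ !mulrDl.
  apply: le_trans (ler_normD _ _) _; apply: lerD.
    apply: le_trans (ler_normD _ _) _; apply: lerD.
      apply: le_trans (ler_normD _ _) _; apply: lerD; first exact: H1.
      by rewrite normrM normrN normr_nat -[leRHS]mulrA ler_wpM2l.
    by rewrite normrM normrN1 mul1r; exact: H3.
  by rewrite normrM normr_nat -[leRHS]mulrA ler_wpM2l.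
rewrite iterS /fdiff exprSr mulrA.
have := lipschitz_is_derive (is_derive_iter_fdiff h M (is_derive_bump a b)) H t (t + h).
by rewrite (addrC t h) addrK addrC.
Qed.

End bump.

(** * Tensor products of bumps *)

Section tensor.
Context {R : realType} (m n : nat).
Local Notation V := 'M[R]_(m, n).
Local Notation I := ('I_m * 'I_n)%type.
Implicit Types (x : V) (g : I -> R -> R).

Definition tensor g x : R := \prod_(ij : I) g ij (x ij.1 ij.2).

Lemma tensor_shift g x (eta : R) i j :
  tensor g (x + eta *: delta_mx i j) =
  g (i, j) (x i j + eta) * \prod_(ij | ij != (i, j)) g ij (x ij.1 ij.2).
Proof.
rewrite /tensor (bigD1 (i, j))//=; congr (_ * _).
  by rewrite !mxE !eqxx mulr1.
apply: eq_bigr => -[i' j'] /= ij; rewrite !mxE.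
by move: ij; rewrite xpair_eqE => /negbTE ->; rewrite mulr0 addr0.
Qed.

Lemma tensorD1 g x i j :
  tensor g x = g (i, j) (x i j) * \prod_(ij | ij != (i, j)) g ij (x ij.1 ij.2).
Proof. by rewrite /tensor (bigD1 (i, j)). Qed.

Lemma prod_others_shift g x (eta : R) i j :
  \prod_(ij | ij != (i, j)) g ij ((x + eta *: delta_mx i j) ij.1 ij.2) =
  \prod_(ij | ij != (i, j)) g ij (x ij.1 ij.2).
Proof.
apply: eq_bigr => -[i' j'] /= ij; rewrite !mxE.
by move: ij; rewrite xpair_eqE => /negbTE ->; rewrite mulr0 addr0.
Qed.

Lemma iter_fdiff_tensor g i j (eta : R) k x :
  iter k (fdiff (eta *: delta_mx i j)) (tensor g) x =
  iter k (fdiff eta) (g (i, j)) (x i j) *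
    \prod_(ij | ij != (i, j)) g ij (x ij.1 ij.2).
Proof.
elim: k x => [|k IH] x; first exact: tensorD1.
by rewrite !iterS {1}/fdiff !IH prod_others_shift -mulrBl !mxE !eqxx mulr1.
Qed.

Lemma is_derive_tensor g x i j (dg : R) : is_derive (x i j) 1 (g (i, j)) dg ->
  is_derive x (delta_mx i j) (tensor g)
    (dg * \prod_(ij | ij != (i, j)) g ij (x ij.1 ij.2)).
Proof.
move=> [gd gE]; set K := \prod_(_ | _) _.
have E : (fun h : R => h^-1 *: ((tensor g \o shift x) (h *: delta_mx i j) - tensor g x)) =
   (fun h => (h^-1 *: ((g (i, j) \o shift (x i j)) (h *: 1) - g (i, j) (x i j))) * K).
  apply/funext => h /=; rewrite (addrC _ x) tensor_shift (tensorD1 g x i j) -/K.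
  by rewrite -mulrBl -scalerAl [h *: 1]mulr1 (addrC h).
have cK : (fun h => (h^-1 *: ((g (i, j) \o shift (x i j)) (h *: 1)
    - g (i, j) (x i j))) * K) @ 0^' --> dg * K.
  by apply: cvgMr_tmp; rewrite -gE; exact: gd.
split; first by rewrite /derivable E; apply/cvg_ex; exists (dg * K).
by rewrite /derive E; exact: cvg_lim.
Qed.

Lemma differentiable_tensor g x : (forall ij t, differentiable (g ij) t) ->
  differentiable (tensor g) x.
Proof.
move=> gd; have -> : tensor g = \prod_(ij : I) (g ij \o (fun x => x ij.1 ij.2)).
  by apply/funext => y; rewrite fct_prodE.
apply: (big_ind (fun f : V -> R => differentiable f x)).
- exact: differentiable_cst.
- by move=> f1 f2 ? ?; exact: differentiableM.
- move=> ij _; apply: differentiable_comp => //.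
  exact: differentiable_coord.
Qed.

End tensor.

Section tensor_bump.
Context {R : realType} (m n : nat).
Local Notation V := 'M[R]_(m, n).
Local Notation I := ('I_m * 'I_n)%type.
Variables (c d : R).
Implicit Types (x : V) (k : I -> nat * nat).

(** A bump in the affinely rescaled coordinates; k records in each coordinate the
    powers of 1 / t and 1 / (1 - t) that differentiation produces. *)
Definition tbump k : V -> R :=
  tensor (fun ij t => bump (k ij).1 (k ij).2 (c * t - d)).

(** This space is stable under partial derivatives, so that all Schwartz
    estimates reduce to boundedness and support of its members. *)
Inductive tbump_span : (V -> R) -> Prop :=
| tbump_span_base k : tbump_span (tbump k)
| tbump_spanD f g : tbump_span f -> tbump_span g -> tbump_span (fun x => f x + g x)
| tbump_spanZ a f : tbump_span f -> tbump_span (fun x => a * f x).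

Lemma is_derive_affine_bump (a b : nat) (t : R) :
  is_derive t 1 (fun t => bump a b (c * t - d)) (c * dbump a b (c * t - d)).
Proof.
have dA : is_derive t 1 (fun t : R => c * t - d) c.
  have := is_deriveB (is_deriveZ c (is_derive_id t (1 : R))) (is_derive_cst d t 1).
  by rewrite subr0 [_ *: _]mulr1.
have := @is_derive1_comp _ (bump a b) (fun t => c * t - d) t _ _
  (is_derive_bump a b _) dA.
by rewrite mulrC.
Qed.

Lemma differentiable_tbump k x : differentiable (tbump k) x.
Proof.
apply: differentiable_tensor => ij t; apply/derivable1_diffP.
by have [] := is_derive_affine_bump (k ij).1 (k ij).2 t.
Qed.

Lemma differentiable_span f x : tbump_span f -> differentiable f x.
Proof.
elim => [k|f1 f2 _ ? _ ?|a f1 _ ?].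
- exact: differentiable_tbump.
- exact: differentiableD.
- exact: differentiableZ.
Qed.

Lemma derive_span f i j : tbump_span f -> tbump_span ('D_(delta_mx i j) f).
Proof.
elim => [k|f1 f2 s1 IH1 s2 IH2|a f1 s1 IH1].
- pose K (a b : nat) ij := if ij == (i, j) then (a, b) else k ij.
  pose a := (k (i, j)).1; pose b := (k (i, j)).2.
  have KE a' b' x : tbump (K a' b') x = bump a' b' (c * x i j - d) *
     \prod_(ij | ij != (i, j)) bump (k ij).1 (k ij).2 (c * x ij.1 ij.2 - d).
    rewrite /tbump (tensorD1 _ _ i j) /K eqxx; congr (_ * _).
    by apply: eq_bigr => ij /negbTE ->.
  rewrite (_ : 'D_ _ _ = (fun x => c * (tbump (K a.+2 b) x + ((- a%:R) * tbump (K a.+1 b) x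
    + (-1 * tbump (K a b.+2) x + b%:R * tbump (K a b.+1) x))))).
    do ![exact: tbump_span_base | apply: tbump_spanD | apply: tbump_spanZ].
  apply/funext => x.
  have dx := @is_derive_tensor _ _ _ (fun ij t => bump (k ij).1 (k ij).2 (c * t - d))
    x i j _ (is_derive_affine_bump a b (x i j)).
  rewrite (@derive_val _ _ _ _ _ _ _ dx) !KE /dbump; ring.
- rewrite (_ : 'D_ _ _ = fun x => 'D_(delta_mx i j) f1 x + 'D_(delta_mx i j) f2 x).
    exact: tbump_spanD.
  apply/funext => x; rewrite -deriveD//; exact/diff_derivable/differentiable_span.
- rewrite (_ : 'D_ _ _ = fun x => a * 'D_(delta_mx i j) f1 x).
    exact: tbump_spanZ.
  by apply/funext => x; apply: deriveZ; exact/diff_derivable/differentiable_span.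
Qed.

Lemma tbump_eq0 k x i j : ~~ (0 < c * x i j - d < 1) -> tbump k x = 0.
Proof. by move=> H; rewrite /tbump (tensorD1 _ _ i j) bump_eq0 ?mul0r. Qed.

Lemma tbump_ge0 k x : 0 <= tbump k x.
Proof. by apply: prodr_ge0 => ij _; exact: bump_ge0. Qed.

Lemma tbump_support k x : 0 < c -> (`|d| + 1) / c < `|x| -> tbump k x = 0.
Proof.
move=> c0; rewrite ltNge => dx; have [/existsP[i /existsP[j ij]]|/existsPn H] :=
  boolP [exists i, exists j, ~~ (0 < c * x i j - d < 1)]; first exact: tbump_eq0 ij.
exfalso; move/negP: dx; apply; apply: mx_norm_le => [|i j].
  by rewrite divr_ge0 ?addr_ge0// ltW.
have /existsPn/(_ j) := H i; rewrite negbK => /andP[h1 h2].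
rewrite ler_pdivlMr// mulrC -{1}(gtr0_norm c0) -normrM ler_norml.
by have := ler_norm d; have := ler_norm (- d); rewrite normrN; lra.
Qed.

Lemma span_bounded f : 0 < c -> tbump_span f ->
  (exists2 C, 0 <= C & forall x, `|f x| <= C) /\
  (forall x, (`|d| + 1) / c < `|x| -> f x = 0).
Proof.
move=> c0; elim => [k|f1 f2 _ [[C1 C10 H1] S1] _ [[C2 C20 H2] S2]|a f1 _ [[C1 C10 H1] S1]].
- split; last by move=> x; exact: tbump_support.
  exists (\prod_(ij : I) ((k ij).1`!%:R * (k ij).2`!%:R)); first by apply: prodr_ge0.
  move=> x; rewrite ger0_norm ?tbump_ge0//; apply: ler_prod => ij _.
  by rewrite bump_ge0 bump_le.
- split; last by move=> x xS; rewrite S1 ?S2 ?addr0.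
  exists (C1 + C2); first exact: addr_ge0.
  by move=> x; apply: le_trans (ler_normD _ _) _; exact: lerD.
- split; last by move=> x xS; rewrite S1 ?mulr0.
  exists (`|a| * C1); first exact: mulr_ge0.
  by move=> x; rewrite normrM ler_wpM2l.
Qed.

Lemma enorm_le x : enorm x <= (m * n)%:R * `|x|.
Proof.
rewrite -[leRHS]ger0_norm ?mulr_ge0// -sqrtr_sqr ler_sqrt ?sqr_ge0//.
apply: le_trans (ler_norm _) _; apply: le_trans (normr_dot _ _) _.
rewrite -expr2 exprMn ler_wpM2r ?sqr_ge0// -natrX ler_nat.
by case: (m * n)%N => // p; rewrite expnS expn1 leq_pmulr.
Qed.

Lemma schwartz_span f : 0 < c -> tbump_span f -> schwartzR f.
Proof.
move=> c0 fs s; have {fs} : tbump_span (pderiv s f).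
  by elim: s => //= -[i j] s IH; exact: derive_span.
move: (pderiv s f) => {s} {}f fs; split; first by move=> x; exact: differentiable_span.
move=> N; have [[C C0 fC] f0] := span_bounded c0 fs.
set r := (`|d| + 1) / c; exists ((1 + (m * n)%:R * r) ^+ N * C) => x.
have r0 : 0 <= r by rewrite divr_ge0 ?addr_ge0// ltW.
have [xr|xr] := leP `|x| r; last first.
  by rewrite f0// normr0 mulr0 mulr_ge0// exprn_ge0// addr_ge0// mulr_ge0.
have e0 : 0 <= enorm x by exact: sqrtr_ge0.
have nr0 : 0 <= (m * n)%:R * r by rewrite mulr_ge0.
apply: ler_pM => //; first by rewrite exprn_ge0 ?addr_ge0.
rewrite lerXn2r ?nnegrE ?addr_ge0// lerD2l.
by apply: le_trans (enorm_le x) _; rewrite ler_wpM2l.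
Qed.

Lemma schwartz_tbump k : 0 < c -> schwartz (fun x => (tbump k x)%:C).
Proof.
move=> c0; split; first exact: (schwartz_span c0 (tbump_span_base k)).
rewrite (_ : (fun x => _) = (fun x => 0 * tbump k x)).
  by apply: schwartz_span => //; apply: tbump_spanZ; exact: tbump_span_base.
by apply/funext => x; rewrite mul0r.
Qed.

Lemma measurable_tbump k : measurable_fun setT (tbump k).
Proof.
apply: continuous_mx_measurable => x.
exact/differentiable_continuous/differentiable_tbump.
Qed.

Definition tbump0 : V -> R := tbump (fun=> (0, 0)%N).

Lemma tbump0_le1 x : tbump0 x <= 1.
Proof.
by apply: prodr_ile1 => ij _; rewrite bump_ge0 bump_le1.
Qed.

Lemma tbump0_lower x : (forall i j, 4^-1 <= c * x i j - d <= 3 / 4) ->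
  expR (- 8) ^+ (m * n) <= tbump0 x.
Proof.
move=> H; have -> : expR (- 8) ^+ (m * n) = \prod_(ij : I) expR (- 8) :> R.
  by rewrite prodr_const card_prod !card_ord.
by apply: ler_prod => ij _; rewrite expR_ge0 bump_lower.
Qed.

Lemma iter_fdiff_affine (f : R -> R) (eta : R) (k : nat) (t : R) :
  iter k (fdiff eta) (fun t => f (c * t - d)) t = iter k (fdiff (c * eta)) f (c * t - d).
Proof.
elim: k t => // k IH t; rewrite !iterS {1}/fdiff !IH {3}/fdiff.
by rewrite (_ : c * (t + eta) - d = c * t - d + c * eta)//; ring.
Qed.

Lemma iter_fdiff_real (f : V -> R) (h : V) (k : nat) :
  iter k (fdiff h) (fun x => (f x)%:C) = (fun x => (iter k (fdiff h) f x)%:C).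
Proof. by elim: k => // k /= ->; apply/funext => x; rewrite /fdiff rmorphB. Qed.

End tensor_bump.

(** A difference along a coordinate sees only one factor of the tensor product;
    the constant is uniform over the scales c up to c1. *)
Lemma iter_fdiff_tbump0 (R : realType) (m n M : nat) (c1 : R) : 0 <= c1 ->
  exists2 A : R, 0 <= A & forall (c d : R) i j (eta : R) k (x : 'M[R]_(m, n)),
    (k <= M)%N -> 0 <= c <= c1 -> 0 <= eta ->
    `|iter k (fdiff (eta *: delta_mx i j)) (@tbump0 R m n c d) x| <= A * eta ^+ k.
Proof.
move=> c10.
have /choice[C HC] : forall k, exists C : R, 0 <= C /\
    forall h t, `|iter k (fdiff h) (bump 0 0) t| <= C * `|h| ^+ k.
  by move=> k; have [C C0 H] := @iter_fdiff_bump R k 0 0; exists C.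
exists (\sum_(k < M.+1) C k * c1 ^+ k).
  by apply: sumr_ge0 => k _; rewrite mulr_ge0 ?exprn_ge0//; case: (HC k).
move=> c d i j eta k x kM /andP[c0 cc1] eta0.
rewrite iter_fdiff_tensor normrM.
apply: (@le_trans _ _ (C k * c1 ^+ k * eta ^+ k)); last first.
  rewrite ler_wpM2r ?exprn_ge0// (bigD1 (Ordinal (kM : (k < M.+1)%N)))//= lerDl.
  by apply: sumr_ge0 => k' _; rewrite mulr_ge0 ?exprn_ge0//; case: (HC k').
rewrite -[leRHS]mulr1; apply: ler_pM => //.
  rewrite iter_fdiff_affine; apply: le_trans ((HC k).2 _ _) _.
  rewrite -mulrA -exprMn ler_wpM2l ?(HC k).1// lerXn2r ?nnegrE ?mulr_ge0//.
  by rewrite ger0_norm ?mulr_ge0// ler_wpM2r.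
rewrite normr_prod; apply: prodr_ile1 => ij _; rewrite normr_ge0/=.
by rewrite ger0_norm ?bump_ge0// bump_le1.
Qed.

(** * Fourier transforms of Schwartz functions *)

Section schwartz_fourier.
Context {R : realType} (m n : nat).
Local Notation V := 'M[R]_(m, n).
Local Notation leb := (@lebesgue_mx R m n).
Local Notation normc := (@Normc.normc R).
Implicit Types f : V -> R[i].

Lemma dotDr (x y z : V) : dot x (y + z) = dot x y + dot x z.
Proof. by rewrite !(dotC x) dotDl. Qed.

Lemma dotZr c (x y : V) : dot x (c *: y) = c * dot x y.
Proof. by rewrite !(dotC x) dotZl. Qed.

Lemma norm_le_enorm (x : V) : `|x| <= enorm x.
Proof.
apply: mx_norm_le => [|i j]; first exact: sqrtr_ge0.
rewrite -sqrtr_sqr ler_sqrt; last first.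
  by apply: sumr_ge0 => ? _; apply: sumr_ge0 => ? _; rewrite -expr2 sqr_ge0.
rewrite /dot (bigD1 i)//= (bigD1 j)//= -expr2 -addrA lerDl addr_ge0//.
  by apply: sumr_ge0 => ? _; rewrite -expr2 sqr_ge0.
by apply: sumr_ge0 => ? _; apply: sumr_ge0 => ? _; rewrite -expr2 sqr_ge0.
Qed.

Lemma schwartz_cmeasurable f : schwartz f -> cmeasurable f.
Proof.
move=> [f1 f2]; split; apply: continuous_mx_measurable => x;
  apply: differentiable_continuous; first exact: (f1 [::]).1.
exact: (f2 [::]).1.
Qed.

Lemma schwartz_decay f (N : nat) : schwartz f ->
  exists2 C : R, 0 <= C & forall x, normc (f x) <= C * (1 + `|x|) ^- N.
Proof.
move=> [f1 f2].
have [_ /(_ N)[C1 H1]] := f1 [::]; have [_ /(_ N)[C2 H2]] := f2 [::].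
have H (C : R) (g : V -> R) : (forall x, (1 + enorm x) ^+ N * `|g x| <= C) ->
    forall x, `|g x| <= C * (1 + `|x|) ^- N.
  move=> gC x; have x1 : 0 < 1 + `|x| by rewrite ltr_pwDl.
  rewrite ler_pdivlMr ?exprn_gt0// mulrC; apply: le_trans (gC x).
  rewrite ler_wpM2r// lerXn2r ?nnegrE ?addr_ge0 ?sqrtr_ge0//.
  by rewrite lerD2l norm_le_enorm.
exists (C1 + C2) => [|x].
  rewrite addr_ge0//.
    by apply: le_trans (H1 0); rewrite mulr_ge0// exprn_ge0// addr_ge0 ?sqrtr_ge0.
  by apply: le_trans (H2 0); rewrite mulr_ge0// exprn_ge0// addr_ge0 ?sqrtr_ge0.
apply: le_trans (normc_le_ReIm _) _; rewrite mulrDl.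
by apply: lerD; [exact: (H _ _ H1)|exact: (H _ _ H2)].
Qed.

Lemma integral_weightZ (C : R) : (0 < m * n)%N -> 0 <= C ->
  (\int[leb]_x (C * (1 + `|x|) ^- (2 * (m * n)))%:E <= (C * (2 * 4 ^+ (m * n)))%:E)%E.
Proof.
move=> d0 C0.
have mw : measurable_fun setT (fun x : V => (1 + `|x|) ^- (2 * (m * n))).
  rewrite (_ : (fun x : V => _) = fun x => (1 + `|x|) `^ (- (2 * (m * n))%:R)).
    apply: (measurableT_comp (measurable_powR _)).
    apply: measurable_funD => //; apply: continuous_mx_measurable => x.
    exact: norm_continuous.
  by apply/funext => x; rewrite powR_invn// addr_ge0.
under eq_integral do rewrite EFinM.
rewrite ge0_integralZl_EFin//; last exact/measurable_EFinP.
rewrite [leRHS]EFinM lee_wpmul2l ?lee_fin//.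
apply: le_trans (integral_schwartz_weight (0 : V) d0).
apply: ge0_integral_mono => x _; last by rewrite subr0.
by rewrite lee_fin invr_ge0 exprn_ge0// addr_ge0.
Qed.

Lemma fdiff_fourier f (h x : V) : cintegrable f ->
  fdiff h (fourier f) x = fourier (fun y => (expi (- (2 * pi * dot y h)) - 1) * f y) x.
Proof.
move=> fi; rewrite /fdiff /fourier -cintegralB; try exact: cintegrable_fourier.
congr cintegral; apply/funext => y; rewrite mulrBl mul1r mulrBl; congr (_ - _).
rewrite [RHS]mulrAC [RHS]mulrC -expiD dotDr; congr (_ * expi _); ring.
Qed.

(** A difference of a Fourier transform is the transform of the function times
    a power of a character minus one, which is at most the length of the step
    times the variable; polynomial decay of the function absorbs the latter. *)
Lemma iter_fdiff_fourier f (k : nat) : (0 < m * n)%N -> schwartz f ->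
  exists2 B : R, 0 <= B & forall h x,
    normc (iter k (fdiff h) (fourier f) x) <= B * `|h| ^+ k.
Proof.
set d := (m * n)%N => d0 sf.
pose g h k (y : V) := (expi (- (2 * pi * dot y h)) - 1) ^+ k * f y.
have [C C0 fC] := schwartz_decay (k + 2 * d) sf.
have mg h j : cmeasurable (g h j).
  elim: j => [|j IH].
    by rewrite /g; under eq_fun do rewrite expr0 mul1r; exact: schwartz_cmeasurable.
  rewrite (_ : g h j.+1 = fun y => (expi (- (2 * pi * dot y h)) - 1) * g h j y).
    apply: cmeasurableM => //; apply: cmeasurableB; last exact: cmeasurable_cst.
    exact: cmeasurable_kernel.
  by apply/funext => y; rewrite /g exprS mulrA.
have gle (h : V) j y : (j <= k)%N ->
    normc (g h j y) <= (4 * pi * d%:R * `|h|) ^+ j * C * (1 + `|y|) ^- (2 * d).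
  move=> jk; have y1 : 1 <= 1 + `|y| by rewrite lerDl.
  have y0 := lt_le_trans ltr01 y1.
  rewrite Normc.normcM normcX.
  apply: (@le_trans _ _ ((4 * pi * d%:R * `|h| * `|y|) ^+ j *
     (C * (1 + `|y|) ^- (k + 2 * d)))).
    rewrite ler_pM ?exprn_ge0 ?normc_ge0// lerXn2r ?nnegrE ?normc_ge0//.
      by rewrite !mulr_ge0// pi_ge0.
    apply: le_trans (normc_expi_sub1 _) _; rewrite normrN !normrM.
    rewrite (ger0_norm (pi_ge0 R)) ger0_norm//.
    rewrite [leRHS](_ : _ = 2 * (2 * pi * (d%:R * (`|y| * `|h|)))); last ring.
    by rewrite ler_wpM2l// ler_wpM2l ?mulr_ge0 ?pi_ge0// normr_dot.
  rewrite exprMn exprD invfM.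
  rewrite [leLHS](_ : _ = (4 * pi * d%:R * `|h|) ^+ j * C * (1 + `|y|) ^- (2 * d) *
      (`|y| ^+ j * (1 + `|y|) ^- k)); last ring.
  rewrite ler_piMr//.
    by rewrite !mulr_ge0 ?exprn_ge0 ?mulr_ge0 ?pi_ge0 ?invr_ge0 ?exprn_ge0 ?(ltW y0).
  rewrite ler_pdivrMr ?exprn_gt0// mul1r.
  apply: (@le_trans _ _ ((1 + `|y|) ^+ j)).
    by rewrite lerXn2r ?nnegrE ?(ltW y0)// lerDr.
  by rewrite ler_weXn2l.
have gK (h : V) j : (j <= k)%N -> (\int[leb]_y ((4 * pi * d%:R * `|h|) ^+ j * C *
     (1 + `|y|) ^- (2 * d))%:E <=
    ((4 * pi * d%:R * `|h|) ^+ j * C * (2 * 4 ^+ d))%:E)%E.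
  by move=> jk; apply: integral_weightZ; rewrite // !mulr_ge0 ?exprn_ge0 ?mulr_ge0 ?pi_ge0.
have gi h j : (j <= k)%N -> cintegrable (g h j).
  move=> jk; apply: (cintegrable_le (mg h j) (fun y => gle h j y jk)).
  exact: le_lt_trans (gK h j jk) (ltry _).
have E h j : (j <= k)%N -> iter j (fdiff h) (fourier f) = fourier (g h j).
  elim: j => [_|j IH jk].
    by congr fourier; apply/funext => y; rewrite /g expr0 mul1r.
  rewrite iterS IH ?(ltnW jk)//; apply/funext => x.
  rewrite fdiff_fourier; last by apply: gi; exact: ltnW.
  by congr fourier; apply/funext => y; rewrite /g exprS mulrA.
exists (2 * ((4 * pi * d%:R) ^+ k * C * (2 * 4 ^+ d))) => [|h x].
  by rewrite !mulr_ge0 ?exprn_ge0 ?mulr_ge0 ?pi_ge0.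
rewrite E//.
rewrite [leRHS](_ : _ = 2 * ((4 * pi * d%:R * `|h|) ^+ k * C * (2 * 4 ^+ d))); last first.
  by rewrite (exprMn _ _ `|h|); ring.
apply: normc_cintegral_le (gK h k (leqnn k)).
  by apply: cmeasurableM => //; exact: cmeasurable_kernel.
by move=> y; rewrite Normc.normcM normc_expi mulr1; exact: gle.
Qed.

Lemma cmeasurable_fourier f : (0 < m * n)%N -> schwartz f -> cmeasurable (fourier f).
Proof.
move=> d0 sf; have [B B0 fB] := iter_fdiff_fourier 1 d0 sf.
have lip (g : V -> R) : (forall x y, `|g y - g x| <= B * `|y - x|) -> continuous g.
  move=> gB x; apply/(@cvgrPdist_le _ _ _ (nbhs x) (nbhs_filter x)) => /= e e0; near=> y.
  apply: le_trans (gB _ _) _.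
  rewrite distrC (distrC y).
  apply: (@le_trans _ _ ((B + 1) * `|x - y|)); first by rewrite ler_wpM2r// lerDl.
  rewrite mulrC -ler_pdivlMr ?ltr_wpDl//.
  near: y; apply/nbhs_ballP; exists (e / (B + 1)) => [|z].
    by rewrite /= divr_gt0 ?ltr_wpDl.
  by rewrite mx_norm_ball /ball_ /= => /ltW.
have fxy x y : normc (fourier f y - fourier f x) <= B * `|y - x|.
  by have := fB (y - x) x; rewrite /= /fdiff (addrC x) subrK expr1.
split; apply: continuous_mx_measurable; apply: lip => x y; rewrite -raddfB.
  exact: le_trans (Re_le_normc _) (fxy x y).
exact: le_trans (Im_le_normc _) (fxy x y).
Unshelve. all: by end_near. Qed.

End schwartz_fourier.

(** * The Sobolev norm of a modulated cutoff *)

Section symbol_bound.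
Context {R : realType} (m n : nat).
Local Notation V := 'M[R]_(m, n).
Local Notation leb := (@lebesgue_mx R m n).
Local Notation normc := (@Normc.normc R).
Local Notation d := (m * n)%N.

(** A transform concentrated near - a pays for the displacement with the factor
    L ^ s, since 1 + |x| <= (1 + |a|) (1 + |x + a|); of the 4 d powers of decay in
    the square, 2 d absorb the weight and 2 d give convergence. *)
Lemma sobolev_le (s : R) : (0 < d)%N -> 0 <= s <= d%:R ->
  exists2 K : R, 0 <= K & forall (F : V -> R[i]) (A L : R) (a : V),
    1 <= L -> `|a| <= L -> 0 <= A ->
    (forall x, normc (fourier F x) <= A * (1 + `|x + a|) ^- (2 * d)) ->
    (sobolev s F <= (K * A * L `^ s)%:E)%E.
Proof.
move=> d0 /andP[s0 sd].
pose k0 : R := 1 + 4 * pi ^+ 2 * d%:R ^+ 2.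
have k00 : 0 <= k0 by rewrite addr_ge0// mulr_ge0 ?sqr_ge0// mulr_ge0 ?sqr_ge0.
pose k1 : R := (4 * k0) `^ s * (2 * 4 ^+ d).
have k10 : 0 <= k1 by rewrite mulr_ge0 ?powR_ge0 ?mulr_ge0 ?exprn_ge0.
exists (Num.sqrt k1) => [|F A L a L1 aL A0 FA]; first exact: sqrtr_ge0.
have L0 : 0 <= L by exact: le_trans L1.
have step x : (1 + 4 * pi ^+ 2 * enorm x ^+ 2) `^ s * normc (fourier F x) ^+ 2 <=
    ((4 * k0) `^ s * (L `^ s * A) ^+ 2) * (1 + `|x - - a|) ^- (2 * d).
  rewrite opprK; set y := 1 + `|x + a|.
  have y1 : 1 <= y by rewrite lerDl.
  have y0 : 0 < y by exact: lt_le_trans y1.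
  have xy : 1 + `|x| <= 2 * L * y.
    have : `|x| <= `|x + a| + `|a| by rewrite -{1}(addrK a x) ler_normB.
    have : 1 * `|x + a| <= L * `|x + a| by rewrite ler_wpM2r.
    have : 0 <= L * `|x + a| by rewrite mulr_ge0.
    move=> h1 h2 h3; rewrite [leRHS](_ : _ = 2 * L + 2 * (L * `|x + a|)); last by rewrite /y; ring.
    by move: h1 h2; rewrite mul1r; move: (L * _) h3 => LX; lra.
  have e0 : 0 <= enorm x by exact: sqrtr_ge0.
  have base : 1 + 4 * pi ^+ 2 * enorm x ^+ 2 <= (4 * k0) * (L ^+ 2 * y ^+ 2).
    apply: (@le_trans _ _ (k0 * (1 + `|x|) ^+ 2)).
      rewrite [leRHS](_ : _ = (1 + `|x|) ^+ 2 +
        4 * pi ^+ 2 * d%:R ^+ 2 * (1 + `|x|) ^+ 2); last by rewrite /k0; ring.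
      apply: lerD; first by rewrite exprn_ege1// lerDl.
      rewrite [leRHS](_ : _ = 4 * pi ^+ 2 * (d%:R * (1 + `|x|)) ^+ 2); last ring.
      apply: ler_wpM2l; first by rewrite mulr_ge0 ?sqr_ge0.
      rewrite lerXn2r ?nnegrE ?mulr_ge0 ?addr_ge0//.
      by apply: le_trans (enorm_le x) _; rewrite ler_wpM2l// lerDr.
    rewrite [leRHS](_ : _ = k0 * (2 * L * y) ^+ 2); last by rewrite !exprMn; ring.
    rewrite ler_wpM2l// lerXn2r ?nnegrE ?addr_ge0//.
    by apply: le_trans xy; rewrite addr_ge0.
  apply: (@le_trans _ _ ((4 * k0) `^ s * (L `^ s) ^+ 2 * y ^+ (2 * d) *
      (A * y ^- (2 * d)) ^+ 2)).
    apply: ler_pM; rewrite ?powR_ge0 ?sqr_ge0//; last first.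
      by rewrite lerXn2r ?nnegrE ?normc_ge0 ?mulr_ge0 ?invr_ge0 ?exprn_ge0 ?(ltW y0)// FA.
    apply: (@le_trans _ _ (((4 * k0) * (L ^+ 2 * y ^+ 2)) `^ s)).
      apply: ge0_ler_powR => //; rewrite nnegrE ?(le_trans _ base)// addr_ge0//.
        by rewrite mulr_ge0 ?sqr_ge0// mulr_ge0 ?sqr_ge0.
      by rewrite mulr_ge0 ?sqr_ge0// mulr_ge0 ?sqr_ge0.
    have k4 : 0 <= 4 * k0 by rewrite mulr_ge0.
    have L2 : 0 <= L ^+ 2 by exact: sqr_ge0.
    have y2 : 0 <= y ^+ 2 by exact: sqr_ge0.
    rewrite (powRM _ k4 (mulr_ge0 L2 y2)) (powRM _ L2 y2) -[leRHS]mulrA.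
    rewrite ler_wpM2l ?powR_ge0//.
    have -> : (L `^ s) ^+ 2 = (L ^+ 2) `^ s.
      by rewrite -(powR_mulrn 2 (powR_ge0 L s)) powRAC powR_mulrn.
    rewrite ler_wpM2l ?powR_ge0// exprM -(powR_mulrn d y2).
    by apply: ler_powR => //; rewrite exprn_ege1.
  rewrite !exprMn.
  have yn0 : y ^+ (2 * d) != 0 by rewrite expf_neq0// gt_eqF.
  rewrite le_eqVlt; apply/orP; left; apply/eqP; field.
  exact: yn0.
set X := (L `^ s * A) ^+ 2 in step.
have X0 : 0 <= X by rewrite sqr_ge0.
rewrite /sobolev.
apply: (@le_trans _ _ (((k1 * X)%:E) `^ 2^-1)%E).
  apply: gt0_ler_poweR; rewrite ?invr_ge0//.
  - rewrite in_itv/= leey andbT.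
    by apply: integral_ge0 => x _; rewrite lee_fin mulr_ge0 ?powR_ge0 ?sqr_ge0.
  - by rewrite in_itv/= leey andbT lee_fin; apply: mulr_ge0.
  apply: (@le_trans _ _ (\int[leb]_x (((4 * k0) `^ s * X) * (1 + `|x - - a|) ^- (2 * d))%:E)%E).
    apply: ge0_integral_mono => x _; last by rewrite lee_fin; exact: step.
    by rewrite lee_fin; apply: mulr_ge0; rewrite ?powR_ge0 ?sqr_ge0.
  have mw : measurable_fun setT (fun x : V => (1 + `|x - - a|) ^- (2 * d)).
    rewrite (_ : (fun x : V => _) = fun x => (1 + `|x - - a|) `^ (- (2 * d)%:R)).
      apply: (measurableT_comp (measurable_powR _)).
      apply: measurable_funD => //.
      have mn : measurable_fun setT (fun x : V => `|x|).
        by apply: continuous_mx_measurable => x; exact: norm_continuous.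
      by rewrite opprK; exact: measurableT_comp mn (measurable_shift a).
    by apply/funext => x; rewrite powR_invn// addr_ge0.
  under eq_integral do rewrite EFinM.
  rewrite ge0_integralZl_EFin//; last 2 first.
  - exact/measurable_EFinP.
  - by apply: mulr_ge0 => //; exact: powR_ge0.
  rewrite (_ : (k1 * X)%:E = ((4 * k0) `^ s * X)%:E * (2 * 4 ^+ d)%:E)%E; last first.
    by rewrite -EFinM /k1; congr EFin; ring.
  apply: lee_wpmul2l; last exact: integral_schwartz_weight.
  by rewrite lee_fin; apply: mulr_ge0 => //; exact: powR_ge0.
rewrite poweR_EFin lee_fin (powR12_sqrt (mulr_ge0 k10 X0)) (sqrtrM _ k10).
rewrite /X sqrtr_sqr ger0_norm; last by apply: mulr_ge0 => //; exact: powR_ge0.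
by rewrite mulrA mulrAC.
Qed.

Section dyadic_pieces.
Variable Psi : V -> R[i].
Hypotheses (d0 : (0 < d)%N) (hPsi : dyadic_partition Psi).

Lemma fourier_Psi_support xi : fourier Psi xi != 0 -> 2^-1 <= enorm xi <= 2.
Proof.
have [_ supp _] := hPsi => xi0; apply: supp.
exact: subset_closure.
Qed.

Definition piece (c : R) : V -> R[i] :=
  fun xi => (tbump0 c 1 xi)%:C * fourier Psi xi.

(** The frequency cutoff and the annulus carrying the transform of Psi do not
    meet once the cutoff is rescaled too far. *)
Lemma piece_eq0 c xi : 4 * d%:R < c -> piece c xi = 0.
Proof.
move=> dc; rewrite /piece; have [->|xi0] := eqVneq (fourier Psi xi) 0.
  by rewrite mulr0.
have d0' : 0 < d%:R :> R by rewrite ltr0n.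
have c0 : 0 < c by apply: lt_trans dc; rewrite mulr_gt0.
have /andP[xi2 _] := fourier_Psi_support xi0.
have [xic|xic] := ltP (2 / c) `|xi|.
  by rewrite /tbump0 tbump_support ?mul0r// normr1.
exfalso; move: xi2; rewrite leNgt => /negP; apply.
apply: le_lt_trans (enorm_le xi) _.
apply: (@le_lt_trans _ _ (d%:R * (2 / c))); first by rewrite ler_wpM2l// ltW.
by rewrite mulrA ltr_pdivrMr//; lra.
Qed.

(** Cutoff and transform of Psi both have differences of all orders bounded by
    powers of the step, uniformly in the scale, and so does their product. *)
Lemma piece_decay (M : nat) (c1 : R) : 0 <= c1 ->
  exists2 D : R, 0 <= D & forall c x, 0 <= c <= c1 ->
    normc (fourier (piece c) x) <= D * (1 + `|x|) ^- M.
Proof.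
move=> c10; have [sPsi _ _] := hPsi.
have [A A0 HA] := @iter_fdiff_tbump0 R m n M c1 c10.
have /choice[B HB] : forall k, exists B : R, 0 <= B /\ forall (h x : V),
    normc (iter k (fdiff h) (fourier Psi) x) <= B * `|h| ^+ k.
  by move=> k; have [B B0 H] := iter_fdiff_fourier k d0 sPsi; exists B.
pose B1 := \sum_(k < M.+1) B k.
have BB1 k : (k <= M)%N -> B k <= B1.
  move=> kM; rewrite /B1 (bigD1 (Ordinal (kM : (k < M.+1)%N)))//= lerDl.
  by apply: sumr_ge0 => k' _; case: (HB k').
have B10 : 0 <= B1 by apply: le_trans (BB1 0%N isT); case: (HB 0%N).
pose A1 := 2 ^+ M * (A * B1).
have A10 : 0 <= A1 by rewrite /A1 mulr_ge0 ?exprn_ge0// mulr_ge0.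
have A1le : A * B1 <= A1 by rewrite /A1 ler_peMl ?mulr_ge0// exprn_ege1// ler1n.
exists (2 ^+ M * 2 * (2 * (2 + M%:R)) ^+ d * (A1 + B1)) => [|c x cc1].
  apply: mulr_ge0; last exact: addr_ge0.
  by rewrite mulr_ge0 ?mulr_ge0 ?exprn_ge0// mulr_ge0// addr_ge0.
have fourier_le xi : normc (fourier Psi xi) <= B1.
  by apply: le_trans (BB1 0%N isT); have := (HB 0%N).2 0 xi; rewrite expr0 mulr1.
apply: fourier_decay => //.
- apply: cmeasurableM; last exact: cmeasurable_fourier.
  by apply: cmeasurable_real; exact: measurable_tbump.
- move=> xi xi2; rewrite /piece; have [->|xi0] := eqVneq (fourier Psi xi) 0.
    by rewrite mulr0.
  have /andP[_] := fourier_Psi_support xi0.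
  by rewrite leNgt (lt_le_trans xi2)// norm_le_enorm.
- move=> xi; rewrite Normc.normcM normc_real; apply: (@le_trans _ _ (1 * B1)).
    apply: ler_pM => //; first exact: normc_ge0.
    by rewrite ger0_norm ?tbump_ge0// tbump0_le1.
  by rewrite mul1r lerDr.
- move=> i j eta xi eta0; apply: (@le_trans _ _ (A1 * eta ^+ M)); last first.
    by rewrite ler_wpM2r ?exprn_ge0// lerDl.
  apply: normc_iter_fdiffM => k y kM.
    by rewrite iter_fdiff_real normc_real; exact: HA.
  apply: le_trans ((HB k).2 _ _) _; apply: ler_pM => //; first by case: (HB k).
    exact: BB1.
  rewrite lerXn2r ?nnegrE//; apply: mx_norm_le => // i' j'.
  rewrite !mxE normrM (ger0_norm eta0) -[leRHS]mulr1 ler_wpM2l//.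
  by case: (_ && _); rewrite ?normr0 ?normr1.
Qed.

(** The character e (- sum of the coordinates) translates by the all-one vector;
    the cutoff localizes it to frequencies of size del * N. *)
Definition osc_symbol (del N : R) : V -> R[i] := fun xi =>
  expi (- (2 * pi * dot xi (const_mx 1))) * (tbump0 (del * N)^-1 1 xi)%:C.

Lemma symbol_osc del N : symbol (osc_symbol del N).
Proof.
have [m1 m2] : cmeasurable (osc_symbol del N).
  apply: cmeasurableM; first exact: cmeasurable_kernel.
  by apply: cmeasurable_real; exact: measurable_tbump.
split => //; exists 1 => xi.
by rewrite Normc.normcM normc_expi mul1r normc_real ger0_norm ?tbump_ge0// tbump0_le1.
Qed.

Lemma fourier_osc_piece (del N t : R) x :
  fourier (fun xi => osc_symbol del N (t *: xi) * fourier Psi xi) x =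
  fourier (piece (t / (del * N))) (x + t *: const_mx 1).
Proof.
congr cintegral; apply/funext => xi; rewrite /osc_symbol /piece.
have -> : tbump0 (del * N)^-1 1 (t *: xi) = tbump0 (t / (del * N)) 1 xi.
  by apply: eq_bigr => ij _; rewrite mxE; congr (bump _ _ (_ - _)); ring.
transitivity ((tbump0 (t / (del * N)) 1 xi)%:C * fourier Psi xi *
  (expi (- (2 * pi * dot (t *: xi) (const_mx 1))) * expi (- (2 * pi * dot xi x)))).
  by ring.
rewrite -expiD dotZl dotDr dotZr; congr (_ * expi _); ring.
Qed.

(** At the dyadic scale 2 ^ k the character is a translation by a vector of length
    2 ^ k, and the pieces with 2 ^ k > N vanish: hence the power N ^ s. *)
Lemma symbol_norm_osc_le (s : R) : 0 <= s <= d%:R ->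
  exists2 K : R, 0 <= K & forall del N : R, 0 < del -> 4 * d%:R * del <= 1 ->
    1 <= N -> (symbol_norm s Psi (osc_symbol del N) <= (K * N `^ s)%:E)%E.
Proof.
move=> s0d; have [K K0 HK] := sobolev_le d0 s0d.
have c10 : 0 <= 4 * d%:R :> R by rewrite mulr_ge0.
have [D D0 HD] := piece_decay (2 * d) c10.
exists (K * D) => [|del N del0 deld N1]; first exact: mulr_ge0.
have N0 : 0 < N by exact: lt_le_trans N1.
apply: ge_ereal_sup => _ [k _ <-].
have t0 : 0 < 2 ^ k :> R by rewrite exprz_gt0.
set t : R := 2 ^ k in t0 *.
have dN0 : 0 < del * N by rewrite mulr_gt0.
have [tle|tgt] := leP (t / (del * N)) (4 * d%:R).
- apply: (HK _ D N (t *: const_mx 1)) => // [|x].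
    apply: mx_norm_le => [|i j]; first exact: ltW.
    rewrite !mxE mulr1 gtr0_norm//; move: tle; rewrite ler_pdivrMr// => /le_trans.
    by apply; rewrite mulrA ler_piMl// ltW.
  rewrite fourier_osc_piece; apply: HD.
  by rewrite tle divr_ge0 ?ltW.
- apply: (HK _ D N 0) => //; first by rewrite normr0 ltW.
  move=> x; rewrite fourier_osc_piece (_ : fourier _ _ = 0).
    by rewrite Normc.normc0 mulr_ge0// invr_ge0 exprn_ge0// addr_ge0.
  rewrite /fourier (_ : (fun x => _) = cst 0).
    by rewrite /cintegral /Rintegral !integral0.
  by apply/funext => xi; rewrite piece_eq0 ?mul0r.
Qed.

End dyadic_pieces.

End symbol_bound.

(** * Power weights *)

Section power_weight.
Context {R : realType} (m n : nat).
Local Notation V := 'M[R]_(m, n).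
Local Notation leb := (@lebesgue_mx R m n).
Local Notation d := (m * n)%N.
Variable al : R.
Hypothesis ald : 0 < al < d%:R.

Definition rpow (x : V) : R := `|x| `^ (- al).

Lemma rpow_ge0 x : 0 <= rpow x. Proof. exact: powR_ge0. Qed.

Lemma rpow0 : rpow 0 = 0.
Proof. by move/andP: ald => [a0 _]; rewrite /rpow normr0 powR0// oppr_eq0 gt_eqF. Qed.

Lemma rpow_gt0 x : x != 0 -> 0 < rpow x.
Proof. by move=> x0; rewrite powR_gt0// normr_gt0. Qed.

Lemma powRN_anti (a x y : R) : 0 <= a -> 0 < x -> x <= y -> y `^ (- a) <= x `^ (- a).
Proof.
move=> a0 x0 xy; have y0 := lt_le_trans x0 xy.
rewrite !powRN lef_pV2 ?posrE ?powR_gt0//.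
by apply: ge0_ler_powR => //; rewrite nnegrE ltW.
Qed.

Lemma measurable_rpow (z : V) : measurable_fun setT (fun x : V => rpow (x - z)).
Proof.
apply: (measurableT_comp (measurable_powR _)).
have mn : measurable_fun setT (fun x : V => `|x|).
  by apply: continuous_mx_measurable => x; exact: norm_continuous.
exact: measurableT_comp mn (measurable_shift (- z)).
Qed.

Lemma cubeE (a : V) h : cube a h = box a (a + const_mx h).
Proof. by apply/seteqP; split => x H i j; have := H i j; rewrite !mxE. Qed.

Lemma measurable_cube (a : V) h : measurable (cube a h).
Proof. by rewrite cubeE; exact: measurable_box. Qed.

Lemma lebesgue_cube (a : V) h : 0 <= h -> leb (cube a h) = (h ^+ d)%:E.
Proof.
move=> h0; rewrite cubeE lebesgue_mx_box => [|i j]; last by rewrite !mxE lerDl.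
congr EFin; rewrite (eq_bigr (fun=> h ^+ n)).
  by rewrite prodr_const card_ord -exprM mulnC.
move=> i _; rewrite (eq_bigr (fun=> h)) ?prodr_const ?card_ord//.
by move=> j _; rewrite !mxE; ring.
Qed.

Lemma cube_diam (a : V) h x y : 0 <= h -> cube a h x -> cube a h y -> `|x - y| <= h.
Proof.
move=> h0 xQ yQ; apply: mx_norm_le => // i j.
by have := xQ i j; have := yQ i j; rewrite !mxE ler_norml; lra.
Qed.

(** The A_1 property, with the infimum over the cube replaced by a lower bound t.
    Either the cube is far from the pole, where the weight is almost constant, or
    it lies in a ball around the pole of comparable radius. *)
Lemma rpow_A1 : exists2 C : R, 0 < C & forall (z a : V) (h : R), 0 < h ->
  exists t : R, [/\ 0 < t,
    forall x, cube a h x -> x != z -> t <= rpow (x - z) &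
    (\int[leb]_(x in cube a h) (rpow (x - z))%:E <= (C * t * h ^+ d)%:E)%E].
Proof.
have /andP[al0 ald'] := ald; have [K K0 HK] := integral_cball_powR ald.
exists (3 `^ al + K * 2 ^+ d) => [|z a h h0].
  by rewrite addr_gt0 ?powR_gt0// mulr_gt0 ?exprn_gt0.
have hd0 : 0 <= h ^+ d by rewrite exprn_ge0// ltW.
have [[x0 [x0Q x0h]]|far] := pselect (exists x0, cube a h x0 /\ 2 * h <= `|x0 - z|).
(* Far from the pole: |x - z| stays between (X + h) / 3 and X + h. *)
- set X := `|x0 - z| in x0h; have X0 : 0 < X by apply: lt_le_trans x0h; rewrite mulr_gt0.
  have Xh0 : 0 < X + h by rewrite addr_gt0.
  exists ((X + h) `^ (- al)); split; first by rewrite powR_gt0.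
    move=> x xQ xz; apply: powRN_anti; rewrite ?(ltW al0)// ?normr_gt0 ?subr_eq0//.
    apply: le_trans (ler_distD x0 x z) _; rewrite addrC lerD2l.
    exact: (cube_diam (ltW h0) xQ x0Q).
  apply: (@le_trans _ _ (\int[leb]_(x in cube a h) ((3 `^ al) * (X + h) `^ (- al))%:E)%E).
    apply: ge0_integral_mono => x xQ; rewrite lee_fin; first exact: rpow_ge0.
    have xlow : (X + h) / 3 <= `|x - z|.
      have := cube_diam (ltW h0) x0Q xQ.
      by have := ler_distD x x0 z; rewrite -/X; lra.
    apply: le_trans (powRN_anti (ltW al0) _ xlow) _; first by rewrite divr_gt0.
    rewrite powRM ?invr_ge0 ?(ltW Xh0)// mulrC ler_wpM2r ?powR_ge0//.
    by rewrite -(powR_inv1 (ler0n R 3)) -powRrM mulrNN mul1r.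
  rewrite integral_cst; last exact: measurable_cube.
  rewrite [X in (_ * X)%E](_ : _ = (h ^+ d)%:E); last exact: lebesgue_cube (ltW h0).
  rewrite lee_fin !mulrDl ler_wpDr// mulr_ge0// mulr_ge0 ?powR_ge0//.
  by rewrite mulr_ge0 ?exprn_ge0// ltW.
- exists ((2 * h) `^ (- al)); have h20 : 0 < 2 * h by rewrite mulr_gt0.
  split; first by rewrite powR_gt0.
    move=> x xQ xz; apply: powRN_anti; rewrite ?(ltW al0)// ?normr_gt0 ?subr_eq0//.
    by rewrite leNgt; apply/negP => H; apply: far; exists x; split=> //; exact: ltW.
  apply: (@le_trans _ _ (\int[leb]_(x in cball z (2 * h)) (rpow (x - z))%:E)%E).
    apply: ge0_subset_integral => //; [exact: measurable_cube|exact: measurable_cball| | |].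
    - apply/measurable_EFinP; apply: measurable_funTS; exact: measurable_rpow.
    - by move=> x _; rewrite lee_fin rpow_ge0.
    - move=> x xQ; rewrite /cball/= ltW// ltNge; apply/negP => H.
      by apply: far; exists x.
  apply: le_trans (HK z (2 * h) h20) _; rewrite lee_fin.
  rewrite addrC powRD ?(gt_eqF h20) ?implybT// powR_mulrn ?(ltW h20)// exprMn.
  rewrite [leLHS](_ : _ = K * 2 ^+ d * (2 * h) `^ (- al) * h ^+ d); last ring.
  rewrite !mulrDl lerDr mulr_ge0// mulr_ge0 ?powR_ge0//.
Qed.

Lemma average_le (a : V) (h c B : R) (f g : V -> R) : 0 < h -> 0 <= c ->
  measurable_fun setT g -> (forall x, 0 <= g x) ->
  (forall x, cube a h x -> 0 <= f x <= c * g x) ->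
  (\int[leb]_(x in cube a h) (g x)%:E <= (B * h ^+ d)%:E)%E ->
  (0 <= average (cube a h) f <= (c * B)%:E)%E.
Proof.
move=> h0 c0 mg g0 fg gB; have hd0 : 0 < h ^+ d by rewrite exprn_gt0.
rewrite /average.
have -> : leb (cube a h) = (h ^+ d)%:E by apply: lebesgue_cube; exact: ltW.
have i0 : (0 <= \int[leb]_(x in cube a h) (f x)%:E)%E.
  by apply: integral_ge0 => x /fg /andP[]; rewrite lee_fin.
rewrite inver gt_eqF//; apply/andP; split.
  by rewrite mule_ge0// lee_fin invr_ge0 ltW.
rewrite (_ : (c * B)%:E = ((h ^+ d)^-1)%:E * (c * (B * h ^+ d))%:E)%E; last first.
  by rewrite -EFinM; congr EFin; field; rewrite gt_eqF.
apply: lee_wpmul2l; first by rewrite lee_fin invr_ge0 ltW.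
apply: (@le_trans _ _ (\int[leb]_(x in cube a h) (c * g x)%:E)%E).
  by apply: ge0_integral_mono => x /fg /andP[]; rewrite !lee_fin.
under eq_integral do rewrite EFinM.
rewrite ge0_integralZl_EFin//; last 3 first.
- exact: measurable_cube.
- by move=> x _; rewrite lee_fin.
- by apply/measurable_EFinP; exact: measurable_funTS.
by rewrite [leRHS]EFinM lee_wpmul2l.
Qed.

End power_weight.

(** * Multiple weights with a zero and a pole *)

Section two_pole_weight.
Context {R : realType} (n : nat).
Local Notation E := 'rV[R]_n.
Local Notation leb := (@lebesgue_mx R 1 n).
Local Notation d := (1 * n)%N.
Variable al : R.
Hypothesis ald : 0 < al < d%:R.
Local Notation u := (@rpow R 1 n al).
Local Notation e := (const_mx 1 : E).

(** The product of an A_1 weight singular at e and a negative power of one singular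
    at 0, as in the factorization of A_r weights: large near e, small near 0. *)
Definition two_pole (r : R) (x : E) : R := u (x - e) * u x `^ (1 - r).

Let al0 : 0 < al. Proof. by case/andP: ald. Qed.

Lemma dim_gt0 : (0 < d)%N.
Proof. by have /andP[a0 aN] := ald; rewrite -(ltr0n R); exact: lt_trans aN. Qed.

Lemma two_pole_ge0 r x : 0 <= two_pole r x.
Proof. by rewrite mulr_ge0// powR_ge0. Qed.

Lemma two_pole_0 r : 1 < r -> two_pole r 0 = 0.
Proof. by move=> r1; rewrite /two_pole (rpow0 ald) powR0 ?mulr0// subr_eq0 lt_eqF. Qed.

Lemma two_pole_e r : two_pole r e = 0.
Proof. by rewrite /two_pole subrr (rpow0 ald) mul0r. Qed.

Lemma two_pole_gt0 r x : x != 0 -> x != e -> 0 < two_pole r x.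
Proof.
move=> x0 xe; apply: mulr_gt0; first by apply: rpow_gt0; rewrite subr_eq0.
by apply: powR_gt0; exact: rpow_gt0.
Qed.

Lemma two_pole_powE r (x : E) : u x `^ (1 - r) = `|x| `^ (al * (r - 1)).
Proof. by rewrite /rpow -powRrM; congr (_ `^ _); ring. Qed.

Lemma measurable_two_pole r : measurable_fun setT (two_pole r).
Proof.
apply: measurable_funM; first exact: measurable_rpow.
apply: (measurableT_comp (measurable_powR _)).
by have := measurable_rpow al (0 : E); under eq_fun do rewrite subr0.
Qed.

Lemma weight_two_pole r : 1 < r -> weight (two_pole r).
Proof.
move=> r1; split.
- exact: measurable_two_pole.
- exact: two_pole_ge0.
- have nz z : leb.-negligible (cball z 0).
    exists (cball z 0); split => //; first exact: measurable_cball.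
    by apply: etrans (lebesgue_cball z (lexx 0)) _; rewrite mulr0 expr0n eqn0Ngt dim_gt0.
  apply: (negligibleS _ (negligibleU (nz 0) (nz e))).
  move=> x /= nx; have [->|x0] := eqVneq x 0.
    by left; rewrite /cball/= subr0 normr0.
  have [->|xe] := eqVneq x e; first by right; rewrite /cball/= subrr normr0.
  by exfalso; apply: nx; exact: two_pole_gt0.
- move=> K cK; have [M [_ KM]] := compact_bounded cK.
  pose M1 := `|M| + 1; have M10 : 0 < M1 by rewrite ltr_wpDl.
  have {}KM x : K x -> `|x| <= M1.
    by move=> Kx; apply: (KM M1) => //; rewrite /M1 (le_lt_trans (ler_norm M))// ltrDl.
  have [C C0 HC] := integral_cball_powR ald.
  apply: (@le_lt_trans _ _ (\int[leb]_(x in cball e (M1 + 1))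
      (M1 `^ (al * (r - 1)) * u (x - e))%:E)%E).
    rewrite (integral_mkcond K) (integral_mkcond (cball e _)).
    apply: ge0_integral_mono => x _.
      by apply: erestrict_ge0 => ? ?; rewrite lee_fin two_pole_ge0.
    rewrite !patchE; case: ifPn => [|_]; last first.
      by case: ifP => // _; rewrite lee_fin mulr_ge0 ?powR_ge0.
    rewrite inE => /KM xM; rewrite ifT; last first.
      rewrite inE /cball/= (le_trans (ler_normB _ _))// lerD//.
      by apply: mx_norm_le => // i j; rewrite mxE normr1.
    rewrite lee_fin /two_pole mulrC ler_wpM2r ?rpow_ge0// two_pole_powE.
    apply: ge0_ler_powR => //; rewrite ?nnegrE ?(ltW M10)//.
    by rewrite mulr_ge0 ?subr_ge0// ltW.
  under eq_integral do rewrite EFinM.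
  rewrite ge0_integralZl_EFin//; last 4 first.
  - exact: measurable_cball.
  - by move=> x _; rewrite lee_fin rpow_ge0.
  - by apply/measurable_EFinP; apply: measurable_funTS; exact: measurable_rpow.
  - exact: powR_ge0.
  apply: lte_mul_pinfty; rewrite ?lee_fin ?powR_ge0//.
  by apply: le_lt_trans (HC e (M1 + 1) _) (ltry _); rewrite addr_gt0.
Qed.

Section multiple.
Context {l : nat} (r : 'I_l -> R).
Hypotheses (l0 : (0 < l)%N) (r1 : forall j, 1 < r j).
Local Notation H := (Defs.harmonic r).

Let r0 j : 0 < r j. Proof. exact: lt_trans (r1 j). Qed.

Lemma sum_inv_gt0 : 0 < \sum_j (r j)^-1.
Proof.
rewrite (bigD1 (Ordinal l0))//= ltr_pwDl ?invr_gt0//.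
by apply: sumr_ge0 => j _; rewrite invr_ge0 ltW.
Qed.

Lemma harmonic_gt0 : 0 < H.
Proof. by rewrite invr_gt0 sum_inv_gt0. Qed.

Lemma sum_harmonic : \sum_j H / r j = 1.
Proof. by rewrite -mulr_sumr mulVf// gt_eqF// sum_inv_gt0. Qed.

Lemma prod_powR (x : R) (a : 'I_l -> R) : 0 < x -> \prod_j x `^ a j = x `^ (\sum_j a j).
Proof.
move=> x0; rewrite /powR gt_eqF// mulr_suml expR_sum.
by apply: eq_bigr => j _.
Qed.

Lemma prod_powR_ge0 (x : R) : 0 <= x -> \prod_j x `^ (H / r j) = x.
Proof.
rewrite le_eqVlt => /predU1P[<-|x0]; last first.
  by rewrite prod_powR// sum_harmonic powRr1// ltW.
rewrite (bigD1 (Ordinal l0))//= powR0 ?mul0r//.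
by rewrite gt_eqF// divr_gt0// harmonic_gt0.
Qed.

Local Notation kappa := (\sum_j (1 - r j) * (H / r j)).

Lemma joint_weight_ge0 (w : 'I_l -> E -> R) x : 0 <= joint_weight r w x.
Proof. by apply: prodr_ge0 => j _; exact: powR_ge0. Qed.

Lemma joint_two_pole_le (t : R) x : 0 < t -> (x != 0 -> t <= u x) ->
  joint_weight r (fun j => two_pole (r j)) x <= t `^ kappa * u (x - e).
Proof.
move=> t0 tu; rewrite -(prod_powR_ge0 (rpow_ge0 al (x - e))) -prod_powR//.
rewrite -big_split/=; apply: ler_prod => j _; rewrite powR_ge0/=.
have Hr : 0 < H / r j by rewrite divr_gt0// harmonic_gt0.
have [->|x0] := eqVneq x 0.
  by rewrite two_pole_0// powR0 ?gt_eqF// mulr_ge0// powR_ge0.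
rewrite /two_pole (powRM _ (rpow_ge0 al (x - e)) (powR_ge0 (u x) (1 - r j))) mulrC.
apply: ler_wpM2r; first exact: powR_ge0.
rewrite (powRrM t (1 - r j)); apply: ge0_ler_powR; rewrite ?nnegrE ?powR_ge0 ?(ltW Hr)//.
rewrite -(opprB (r j) 1); apply: powRN_anti => //; last exact: tu.
by rewrite subr_ge0 ltW.
Qed.

Lemma dual_two_pole_le (s t : R) x : 1 < s -> 0 < t -> (x != e -> t <= u (x - e)) ->
  two_pole s x `^ (1 - s / (s - 1)) <= t `^ (- (s - 1)^-1) * u x.
Proof.
move=> s1 t0 tu; have s10 : 0 < s - 1 by rewrite subr_gt0.
have -> : 1 - s / (s - 1) = - (s - 1)^-1 by field; rewrite gt_eqF.
have n0 : - (s - 1)^-1 != 0 by rewrite oppr_eq0 invr_eq0 gt_eqF.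
have [->|x0] := eqVneq x 0.
  by rewrite two_pole_0// powR0// mulr_ge0 ?powR_ge0.
have [->|xe] := eqVneq x e.
  by rewrite two_pole_e powR0// mulr_ge0 ?powR_ge0.
rewrite /two_pole (powRM _ (rpow_ge0 al (x - e)) (powR_ge0 (u x) (1 - s))).
rewrite -powRrM (_ : (1 - s) * - (s - 1)^-1 = 1); last by field; rewrite gt_eqF.
rewrite powRr1 ?rpow_ge0// ler_wpM2r ?rpow_ge0//.
by apply: powRN_anti => //; [rewrite invr_ge0 ltW|exact: tu].
Qed.

(** Per weight, the powers of the two lower bounds given by the A_1 property
    cancel between the weight and its dual. *)
Lemma char_factor (C t1 t2 s : R) : 0 < C -> 0 < t1 -> 0 < t2 -> 1 < s ->
  (C `^ s^-1 * t1 `^ s^-1 * t2 `^ ((1 - s) / s)) *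
    (t1 `^ (- (s - 1)^-1) * (C * t2)) `^ ((s / (s - 1))^-1) = C.
Proof.
move=> C0 t10 t20 s1; have s10 : s - 1 != 0 by rewrite gt_eqF// subr_gt0.
have s0 : s != 0 by rewrite gt_eqF// (lt_trans _ s1).
rewrite !powRM ?powR_ge0 ?mulr_ge0 ?(ltW C0) ?(ltW t20)//.
rewrite -powRrM.
rewrite [LHS](_ : _ = (C `^ s^-1 * C `^ ((s / (s - 1))^-1)) *
  (t1 `^ s^-1 * t1 `^ (- (s - 1)^-1 * (s / (s - 1))^-1)) *
  (t2 `^ ((1 - s) / s) * t2 `^ ((s / (s - 1))^-1))); last ring.
rewrite -!powRD ?(gt_eqF C0) ?(gt_eqF t10) ?(gt_eqF t20) ?implybT//.
rewrite (_ : s^-1 + _ = 1); last by field; rewrite ?s0 ?s10.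
rewrite (_ : s^-1 + _ = 0); last by field; rewrite ?s0 ?s10.
rewrite (_ : (1 - s) / s + _ = 0); last by field; rewrite ?s0 ?s10.
by rewrite !powRr0 !mulr1 powRr1// ltW.
Qed.

(** On a cube each of the two A_1 weights has a lower bound t1, t2 comparable to
    its average. In every average of the characteristic one weight occurs with a
    negative power, bounded pointwise, and the other is averaged. *)
Lemma multiple_weight_two_pole : multiple_weight r (fun j => two_pole (r j)).
Proof.
split; first by move=> j; exact: weight_two_pole.
have [C C0 HC] := rpow_A1 ald.
apply: (@le_lt_trans _ _ (C ^+ l)%:E); last exact: ltry.
apply: ge_ereal_sup => _ [a [h [h0 ->]]].
have [t1 [t10 lt1 int1]] := HC e a h h0.
have [t2 [t20 lt2 int2]] := HC 0 a h h0.
have H0 := harmonic_gt0.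
have sub0 : (fun x : E => u (x - 0)) = u by apply/funext => x; rewrite subr0.
have avgv : (0 <= average (cube a h) (joint_weight r (fun j => two_pole (r j)))
    <= (t2 `^ kappa * (C * t1))%:E)%E.
  apply: (@average_le _ _ _ _ _ _ _ _ (fun x => u (x - e))) => //.
  - exact: powR_ge0.
  - exact: measurable_rpow.
  - by move=> x; exact: rpow_ge0.
  - move=> x xQ; rewrite joint_weight_ge0/=; apply: joint_two_pole_le => // x0.
    by have := lt2 x xQ x0; rewrite subr0.
have avgd j : (0 <= dual_average (r j) (cube a h) (two_pole (r j)) <=
    ((t1 `^ (- (r j - 1)^-1) * (C * t2)) `^ ((r j / (r j - 1))^-1))%:E)%E.
  rewrite /dual_average gt_eqF// poweR_ge0/= -poweR_EFin.
  have /andP[A0 A1] : (0 <= average (cube a h)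
      (fun x => two_pole (r j) x `^ (1 - r j / (r j - 1)))%R
       <= (t1 `^ (- (r j - 1)^-1) * (C * t2))%:E)%E.
    apply: (average_le h0 (powR_ge0 _ _) _ (rpow_ge0 al)).
    - by have := measurable_rpow al (0 : E); rewrite sub0.
    - by move=> x xQ; rewrite powR_ge0/=; apply: dual_two_pole_le => // xe; exact: lt1.
    - by move: int2; rewrite (_ : (fun x : E => (u (x - 0))%:E) = (fun x => (u x)%:E))//;
        apply/funext => x; rewrite subr0.
  apply: gt0_ler_poweR; rewrite // ?in_itv/= ?leey ?andbT//.
    by rewrite invr_ge0 divr_ge0 ?subr_ge0 ?ltW.
  exact: le_trans A1.
have prodd : (0 <= \prod_j dual_average (r j) (cube a h) (two_pole (r j)) <=
    (\prod_j (t1 `^ (- (r j - 1)^-1) * (C * t2)) `^ ((r j / (r j - 1))^-1))%:E)%E.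
  exact: lee_prod_EFin.
have /andP[v0 v1] := avgv; have /andP[p0 p1] := prodd.
apply: (@le_trans _ _ (((t2 `^ kappa * (C * t1)) `^ H^-1)%:E *
  (\prod_j (t1 `^ (- (r j - 1)^-1) * (C * t2)) `^ ((r j / (r j - 1))^-1))%:E)%E).
  apply: lee_pmul => //; first exact: poweR_ge0.
  rewrite -poweR_EFin; apply: gt0_ler_poweR; rewrite // ?in_itv/= ?leey ?andbT//.
    by rewrite invr_ge0 ltW.
  exact: le_trans v1.
rewrite -EFinM lee_fin.
have -> : (t2 `^ kappa * (C * t1)) `^ H^-1 =
   \prod_j (C `^ (r j)^-1 * t1 `^ (r j)^-1 * t2 `^ ((1 - r j) / r j)).
  rewrite !big_split/= !prod_powR//.
  rewrite !powRM ?powR_ge0 ?mulr_ge0 ?(ltW C0) ?(ltW t10)// -powRrM.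
  rewrite /Defs.harmonic invrK mulrC; congr (_ * _ `^ _).
  rewrite mulr_suml; apply: eq_bigr => j _.
  set S := \sum_k _; have S0 : S != 0 by rewrite gt_eqF// sum_inv_gt0.
  by field; rewrite S0 gt_eqF.
rewrite -big_split/=; under eq_bigr do rewrite char_factor//.
by rewrite prodr_const card_ord.
Qed.

End multiple.

End two_pole_weight.

(** * The multiplier near the pole *)

Section near_constant_products.
Context {R : realType}.
Local Notation normc := (@Normc.normc R).

(** Expand the product around I; 2 ^ l - 1 counts the nonempty sets of factors in
    which the deviation is taken. *)
Lemma normc_prod_sub (l : nat) (z : 'I_l -> R[i]) (I eps : R) :
  0 <= I -> 0 <= eps <= 1 -> (forall j, normc (z j - I%:C) <= eps * I) ->
  normc (\prod_j z j - (I ^+ l)%:C) <= (2 ^+ l - 1) * eps * I ^+ l.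
Proof.
move=> I0 /andP[e0 e1]; elim: l z => [|l IH] z zI.
  by rewrite big_ord0 !expr0 subrr Normc.normc0 !subrr !mul0r.
rewrite big_ord_recr/=; set A := \prod_(_ < l) _.
have AI : normc (A - (I ^+ l)%:C) <= (2 ^+ l - 1) * eps * I ^+ l by exact: IH.
have -> : A * z ord_max - (I ^+ l.+1)%:C =
   (A - (I ^+ l)%:C) * (z ord_max - I%:C) + (A - (I ^+ l)%:C) * I%:C
   + (I ^+ l)%:C * (z ord_max - I%:C).
  by rewrite exprSr rmorphM/=; ring.
have l1 : 0 <= 2 ^+ l - 1 :> R by rewrite subr_ge0 exprn_ege1// ler1n.
have Il : 0 <= I ^+ l by rewrite exprn_ge0.
apply: le_trans (le_normcD _ _) _.
apply: le_trans (lerD (le_normcD _ _) (lexx _)) _.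
rewrite !Normc.normcM !normc_real (ger0_norm I0) (ger0_norm Il).
have zm := zI ord_max.
have h1 : normc (A - (I ^+ l)%:C) * normc (z ord_max - I%:C) <=
   (2 ^+ l - 1) * eps * I ^+ l * (1 * I).
  apply: ler_pM; rewrite ?normc_ge0//; apply: le_trans zm _.
  by rewrite ler_wpM2r.
have h2 : normc (A - (I ^+ l)%:C) * I <= (2 ^+ l - 1) * eps * I ^+ l * I.
  by rewrite ler_wpM2r.
have h3 : I ^+ l * normc (z ord_max - I%:C) <= I ^+ l * (eps * I).
  by rewrite ler_wpM2l.
apply: le_trans (lerD (lerD h1 h2) h3) _.
by rewrite le_eqVlt; apply/orP; left; apply/eqP; rewrite !exprS; ring.
Qed.

Lemma Re_near (z : R[i]) (a b : R) : normc (z - a%:C) <= b -> a - b <= complex.Re z.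
Proof.
move=> zab; have := le_trans (Re_le_normc _) zab.
by rewrite raddfB/= ler_norml => /andP[? _]; lra.
Qed.

End near_constant_products.

Section lower_bound.
Context {R : realType} (n l : nat).
Local Notation E := 'rV[R]_n.
Local Notation V := 'M[R]_(l, n).
Local Notation d := (l * n)%N.
Local Notation normc := (@Normc.normc R).
Local Notation kap := (expR (- 8) : R).
Local Notation leb := (@lebesgue_mx R 1 n).
Local Notation lebV := (@lebesgue_mx R l n).

Definition test_bump (N : R) (y : E) : R[i] := (tbump0 N 0 y)%:C.

Definition bump_mass (N : R) : R := \int[leb]_y tbump0 N 0 y.

Lemma test_bump_support (N : R) (y : E) : 0 < N -> N^-1 < `|y| -> tbump0 N 0 y = 0.
Proof.
move=> N0 yN; apply: tbump_support => //.
by rewrite normr0 add0r div1r.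
Qed.

Lemma test_bump_cintegrable N : 0 < N -> cintegrable (test_bump N).
Proof.
move=> N0; apply: (@cintegrable_bounded_support _ _ _ _ N^-1 1).
- by apply: cmeasurable_real; exact: measurable_tbump.
- by rewrite invr_ge0 ltW.
- by move=> y; rewrite normc_real ger0_norm ?tbump_ge0// tbump0_le1.
- by move=> y yN; rewrite /test_bump test_bump_support.
Qed.

Lemma integral_ge_box (m k : nat) (a b : 'M[R]_(m, k)) (D : set 'M[R]_(m, k)) (c v : R)
    (g : 'M[R]_(m, k) -> R) :
  (forall i j, a i j <= b i j) -> \prod_i \prod_j (b i j - a i j) = v ->
  0 <= c -> (forall x, D x -> 0 <= g x) -> box a b `<=` D ->
  (forall x, box a b x -> c <= g x) ->
  ((c * v)%:E <= \int[@lebesgue_mx R m k]_(x in D) (g x)%:E)%E.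
Proof.
move=> ab vE c0 g0 abD cg; apply: (@le_trans _ _
  (\int[@lebesgue_mx R m k]_(x in box a b) c%:E)%E).
  rewrite integral_cst; last exact: measurable_box.
  rewrite [X in (_ * X)%E](_ : _ = v%:E) ?EFinM//.
  by apply: etrans (lebesgue_mx_box ab) _; rewrite vE.
rewrite integral_mkcond [leRHS]integral_mkcond.
apply: ge0_integral_mono => x _; first by apply: erestrict_ge0.
rewrite !patchE; case: ifPn => [|_].
  rewrite inE => xab; rewrite ifT; first by rewrite lee_fin; exact: cg.
  by rewrite inE; exact: abD.
by case: ifPn => //; rewrite inE lee_fin; exact: g0.
Qed.

Lemma prod_prod_const (m k : nat) (c : R) : \prod_(i < m) \prod_(j < k) c = c ^+ (m * k).
Proof.
under eq_bigr do rewrite prodr_const card_ord.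
by rewrite prodr_const card_ord -exprM mulnC.
Qed.

Lemma bump_mass_integral N : 0 < N -> (\int[leb]_y (tbump0 N 0 y)%:E = (bump_mass N)%:E)%E.
Proof.
move=> N0; have [fi _] := test_bump_cintegrable N0.
by rewrite /bump_mass /Rintegral fineK//; exact: integrable_fin_num fi.
Qed.

Lemma bump_mass_lower N : 0 < N -> (kap / (2 * N)) ^+ n <= bump_mass N.
Proof.
move=> N0; rewrite -lee_fin -bump_mass_integral//.
rewrite (_ : _ ^+ n = kap ^+ (1 * n) * ((2 * N)^-1) ^+ (1 * n)); last first.
  by rewrite mul1n exprMn.
apply: (@integral_ge_box _ _ (const_mx (4^-1 / N)) (const_mx (3 / 4 / N))).
- move=> i j; rewrite !mxE ler_wpM2r ?invr_ge0 ?(ltW N0)//; lra.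
- rewrite -prod_prod_const; apply: eq_bigr => i _; apply: eq_bigr => j _.
  by rewrite !mxE; field; rewrite gt_eqF.
- by rewrite exprn_ge0// expR_ge0.
- by move=> x _; exact: tbump_ge0.
- by [].
- move=> x xab; apply: tbump0_lower => i j; have := xab i j; rewrite !mxE subr0.
  by rewrite ler_pdivrMr// ler_pdivlMr// mulrC.
Qed.

Lemma bump_mass_gt0 N : 0 < N -> 0 < bump_mass N.
Proof.
move=> N0; apply: lt_le_trans (bump_mass_lower N0).
by apply: exprn_gt0; apply: divr_gt0; [exact: expR_gt0|exact: mulr_gt0].
Qed.

(** The bump lives at scale 1 / N, so on frequencies much smaller than N its
    Fourier transform is close to its integral. *)
Lemma fourier_test_bump_near (N del : R) (eta : E) : 0 < N -> 0 <= del ->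
  `|eta| <= 2 * del * N ->
  normc (fourier (test_bump N) eta - (bump_mass N)%:C) <= 16 * pi * n%:R * del * bump_mass N.
Proof.
move=> N0 del0 etaN; have fi := test_bump_cintegrable N0.
have pi0 := pi_ge0 R.
have -> : (bump_mass N)%:C = cintegral (test_bump N).
  rewrite /cintegral; apply/eqP; rewrite eq_complex eqxx/=; apply/eqP.
  by rewrite /Rintegral integral0.
rewrite /fourier -cintegralB//; last exact: cintegrable_fourier.
rewrite [leRHS](_ : _ = 2 * (8 * pi * n%:R * del * bump_mass N)); last ring.
apply: (@normc_cintegral_le _ _ _ _
  (fun y => 8 * pi * n%:R * del * tbump0 N 0 y)).
- apply: cmeasurableB; last exact: cintegrable_measurable.
  by apply: cintegrable_measurable; exact: cintegrable_fourier.
- move=> y; rewrite -{2}(mulr1 (test_bump N y)) -mulrBr Normc.normcM normc_real.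
  rewrite (ger0_norm (tbump_ge0 _ _ _ _)) -/(tbump0 N 0 y) mulrC.
  have [yN|yN] := leP `|y| N^-1; last by rewrite test_bump_support// !mulr0.
  apply: ler_wpM2r; first exact: tbump_ge0.
  apply: le_trans (normc_expi_sub1 _) _.
  rewrite normrN normrM (ger0_norm (mulr_ge0 (ler0n R 2) pi0)).
  have : `|dot y eta| <= n%:R * (2 * del).
    apply: le_trans (normr_dot _ _) _; rewrite mul1n; apply: ler_wpM2l => //.
    apply: (@le_trans _ _ (N^-1 * (2 * del * N))); first exact: ler_pM.
    by rewrite mulrC mulfK ?gt_eqF.
  move=> H; rewrite [leRHS](_ : _ = 2 * (2 * pi * (n%:R * (2 * del)))); last ring.
  by apply: ler_wpM2l => //; apply: ler_wpM2l => //; exact: mulr_ge0.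
- under eq_integral do rewrite EFinM.
  rewrite ge0_integralZl_EFin//; last 3 first.
  + by move=> y _; rewrite lee_fin tbump_ge0.
  + by apply/measurable_EFinP; exact: measurable_tbump.
  + by apply: mulr_ge0 => //; apply: mulr_ge0 => //; apply: mulr_ge0.
  by rewrite bump_mass_integral.
Qed.

Lemma dot_row_sum (x : E) (xi : V) :
  dot x (\sum_j row j xi) = \sum_j dot x (row j xi).
Proof.
rewrite /dot !big_ord1.
under [RHS]eq_bigr do rewrite big_ord1.
rewrite exchange_big/=; apply: eq_bigr => k _.
by rewrite summxE mulr_sumr.
Qed.

Lemma dot_ones (xi : V) : dot xi (const_mx 1) = dot (const_mx 1 : E) (\sum_j row j xi).
Proof.
rewrite dot_row_sum; apply: eq_bigr => j _; rewrite /dot big_ord1.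
by apply: eq_bigr => k _; rewrite !mxE mulrC.
Qed.

End lower_bound.

Section multiplier_lower_bound.
Context {R : realType} (n l : nat).
Hypotheses (n0 : (0 < n)%N) (l0 : (0 < l)%N).
Local Notation E := 'rV[R]_n.
Local Notation V := 'M[R]_(l, n).
Local Notation d := (l * n)%N.
Local Notation normc := (@Normc.normc R).
Local Notation kap := (expR (- 8) : R).
Local Notation lebV := (@lebesgue_mx R l n).

Lemma norm_row_le (xi : V) j : `|row j xi| <= `|xi|.
Proof. by apply: mx_norm_le => // i k; rewrite mxE entry_le_norm. Qed.

(** Where the cutoff lives, all factors of the integrand have almost the same
    argument, so there is no cancellation. *)
Lemma integrand_near (N del eps : R) (x : E) (xi : V) :
  0 < N -> 0 <= del -> 16 * pi * d%:R * del <= eps -> eps <= 1 ->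
  `|x - const_mx 1| <= N^-1 -> `|xi| <= 2 * del * N ->
  normc ((\prod_j fourier (test_bump N) (row j xi)) *
      expi (2 * pi * dot (x - const_mx 1) (\sum_j row j xi)) -
      (bump_mass n N ^+ l)%:C) <= 2 ^+ l * eps * bump_mass n N ^+ l.
Proof.
move=> N0 del0 deps eps1 xN xiN.
have pi0 := pi_ge0 R.
have eps0 : 0 <= eps.
  by apply: le_trans deps; apply: mulr_ge0 => //; apply: mulr_ge0 => //; apply: mulr_ge0.
have I0 := ltW (bump_mass_gt0 n N0).
have Il0 : 0 <= bump_mass n N ^+ l by exact: exprn_ge0.
set A := \prod_j _; set B := expi _.
have -> : A * B - (bump_mass n N ^+ l)%:C =
  (A - (bump_mass n N ^+ l)%:C) * B + (bump_mass n N ^+ l)%:C * (B - 1) by ring.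
apply: le_trans (le_normcD _ _) _.
rewrite !Normc.normcM normc_expi mulr1 normc_real (ger0_norm Il0).
have hA : normc (A - (bump_mass n N ^+ l)%:C) <= (2 ^+ l - 1) * eps * bump_mass n N ^+ l.
  apply: normc_prod_sub => //; first by rewrite eps0.
  move=> j; apply: le_trans (fourier_test_bump_near N0 del0 (le_trans (norm_row_le xi j) xiN)) _.
  apply: ler_wpM2r => //; apply: le_trans deps; apply: ler_wpM2r => //.
  apply: ler_wpM2l; first exact: mulr_ge0.
  by rewrite ler_nat leq_pmull.
have hB : normc (B - 1) <= eps.
  apply: le_trans (normc_expi_sub1 _) _; rewrite normrM.
  rewrite (ger0_norm (mulr_ge0 (ler0n R 2) pi0)).
  apply: le_trans deps.
  have : `|dot (x - const_mx 1) (\sum_j row j xi)| <= d%:R * (2 * del).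
    rewrite dot_row_sum; apply: le_trans (ler_norm_sum _ _ _) _.
    rewrite natrM -mulrA mulr_natl -[in leRHS](card_ord l) -sumr_const.
    apply: ler_sum => j _; apply: le_trans (normr_dot _ _) _; rewrite mul1n.
    apply: ler_wpM2l => //.
    apply: (@le_trans _ _ (N^-1 * (2 * del * N))).
      by apply: ler_pM => //; exact: le_trans (norm_row_le xi j) xiN.
    by rewrite mulrC mulfK ?gt_eqF.
  move=> H; apply: (@le_trans _ _ (2 * (2 * pi * (d%:R * (2 * del))))).
    by apply: ler_wpM2l => //; apply: ler_wpM2l => //; exact: mulr_ge0.
  have pd : 0 <= pi * d%:R * del by apply: mulr_ge0 => //; exact: mulr_ge0.
  rewrite (_ : 2 * _ = 8 * (pi * d%:R * del)); last ring.
  by rewrite (_ : 16 * _ * _ * _ = 16 * (pi * d%:R * del)); [lra|ring].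
apply: le_trans (lerD hA (ler_wpM2l Il0 hB)) _.
by rewrite le_eqVlt; apply/orP; left; apply/eqP; ring.
Qed.

(** The character in the symbol moves the evaluation point by the all-one vector
    in each of the l variables at once. *)
Lemma multiplier_osc (N del : R) (x : E) (xi : V) :
  osc_symbol del N xi * (\prod_j fourier (test_bump N) (row j xi)) *
    expi (2 * pi * dot x (\sum_j row j xi)) =
  (tbump0 (del * N)^-1 1 xi)%:C * ((\prod_j fourier (test_bump N) (row j xi)) *
      expi (2 * pi * dot (x - const_mx 1) (\sum_j row j xi))).
Proof.
rewrite /osc_symbol dot_ones; set A := \prod_j _; set T := (tbump0 _ _ _)%:C.
set S := \sum_j _.
rewrite (_ : 2 * pi * dot (x - const_mx 1) S =
  - (2 * pi * dot (const_mx 1) S) + 2 * pi * dot x S); last first.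
  by rewrite dotDl -scaleN1r dotZl; ring.
by rewrite expiD; ring.
Qed.

(** The lower bound is uniform in N: the l transforms contribute N ^ (- n l) and
    the volume of the frequency cutoff N ^ (n l). *)
Lemma multiplier_lower : exists del c0 : R,
  [/\ 0 < del, 4 * d%:R * del <= 1, 0 < c0 & forall (N : R) (x : E), 1 <= N ->
    `|x - const_mx 1| <= N^-1 ->
    c0 <= normc (@multiplier R n l (osc_symbol del N) (fun=> test_bump N) x)].
Proof.
have d0 : 0 < d%:R :> R by rewrite ltr0n muln_gt0 l0.
have pi0 : 0 < pi :> R by exact: pi_gt0.
have k0 : 0 < kap by exact: expR_gt0.
pose eps : R := (2 ^+ l * 2)^-1.
have eps0 : 0 < eps by rewrite invr_gt0 mulr_gt0 ?exprn_gt0.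
have eps1 : eps <= 1.
  by rewrite invf_le1 ?mulr_gt0 ?exprn_gt0// mulr_ege1 ?exprn_ege1// ler1n.
have epsE : 2 ^+ l * eps = 2^-1.
  by rewrite /eps invfM mulrA mulfV ?mul1r// expf_neq0.
clearbody eps; pose del := eps / (16 * pi * d%:R).
have del0 : 0 < del by rewrite divr_gt0// mulr_gt0// mulr_gt0.
have delE : 16 * pi * d%:R * del = eps.
  by rewrite /del mulrC divfK// gt_eqF// mulr_gt0// mulr_gt0.
clearbody del; exists del, (kap ^+ d * kap ^+ d * (del / 4) ^+ d / 2); split => //.
- have : pi * (d%:R * del) <= 16^-1.
    rewrite (_ : pi * (d%:R * del) = eps / 16); last by rewrite -delE; field.
    by lra.
  have := pi_ge2 R; have : 0 <= d%:R * del by rewrite mulr_ge0 ?ltW.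
  rewrite -mulrA; move: (d%:R * del) => t t0 p2 H.
  have : 2 * t <= pi * t by rewrite ler_wpM2r.
  by lra.
- by rewrite divr_gt0// !mulr_gt0 ?exprn_gt0// divr_gt0.
move=> N x N1 xN; have N0 : 0 < N by exact: lt_le_trans N1.
have dN0 : 0 < del * N by rewrite mulr_gt0.
set I := bump_mass n N; have I0 : 0 < I by exact: bump_mass_gt0.
have Il0 : 0 < I ^+ l by rewrite exprn_gt0.
pose G (xi : V) := (\prod_j fourier (test_bump N) (row j xi)) *
      expi (2 * pi * dot (x - const_mx 1) (\sum_j row j xi)).
pose T (xi : V) := tbump0 (del * N)^-1 1 xi.
have GI xi : `|xi| <= 2 * del * N -> normc (G xi - (I ^+ l)%:C) <= I ^+ l / 2.
  move=> xiN; apply: le_trans (integrand_near N0 (ltW del0) _ eps1 xN xiN) _.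
    by rewrite delE.
  by rewrite epsE mulrC.
have T0 xi : 2 * del * N < `|xi| -> T xi = 0.
  move=> xiN; apply: tbump_support; first by rewrite invr_gt0.
  by rewrite normr1 invrK mulrA.
have ReTG xi : complex.Re ((T xi)%:C * G xi) = T xi * complex.Re (G xi).
  by rewrite ReM /= mul0r subr0.
have lowb xi : I ^+ l / 2 * T xi <= T xi * complex.Re (G xi).
  have [xiN|/T0 ->] := leP `|xi| (2 * del * N); last by rewrite mulr0 mul0r.
  rewrite mulrC; apply: ler_wpM2l; first exact: tbump_ge0.
  by have := Re_near (GI xi xiN); lra.
have upb xi : T xi * complex.Re (G xi) <= (2 * I ^+ l) * \1_(cball 0 (2 * del * N)) xi.
  have [xiN|xiN] := leP `|xi| (2 * del * N); last first.
    by rewrite T0// mul0r mulr_ge0// mulr_ge0// ltW.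
  rewrite indicE mem_set ?mulr1; last by rewrite /cball/= subr0.
  have : `|complex.Re (G xi - (I ^+ l)%:C)| <= I ^+ l / 2.
    by apply: le_trans (Re_le_normc _) (GI xi xiN).
  rewrite raddfB/= ler_norml => /andP[h1 h2].
  have T1 : T xi <= 1 by exact: tbump0_le1.
  have : T xi * complex.Re (G xi) <= 1 * complex.Re (G xi).
    by rewrite ler_wpM2r//; lra.
  by lra.
rewrite /multiplier.
under [X in cintegral X]eq_fun do rewrite multiplier_osc -/(G _) -/(T _).
apply: le_trans (Re_le_normc _); apply: le_trans (ler_norm _) => /=.
under eq_Rintegral do rewrite ReTG.
have TR0 xi : 0 <= T xi * complex.Re (G xi).
  by apply: le_trans (lowb xi); rewrite mulr_ge0 ?tbump_ge0// divr_ge0// ltW.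
have fin : (\int[lebV]_xi (T xi * complex.Re (G xi))%:E)%E \is a fin_num.
  rewrite ge0_fin_numE; last by apply: integral_ge0 => xi _; rewrite lee_fin.
  apply: (@le_lt_trans _ _ (\int[lebV]_xi ((2 * I ^+ l) *
     \1_(cball 0 (2 * del * N)) xi)%:E)%E).
    by apply: ge0_integral_mono => xi _; rewrite lee_fin.
  rewrite integral_cball_cst ?ltry// ltW// mulr_gt0//.
  by rewrite mulr_gt0.
rewrite -lee_fin /Rintegral fineK//.
apply: (@le_trans _ _ (((I ^+ l / 2) * kap ^+ d) * (del * N / 2) ^+ d)%:E).
  rewrite lee_fin.
  rewrite [leLHS](_ : _ = (kap / (2 * N)) ^+ n ^+ l * (kap ^+ d * (del * N / 2) ^+ d / 2)).
    rewrite [leRHS](_ : _ = I ^+ l * (kap ^+ d * (del * N / 2) ^+ d / 2)); last by ring.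
    apply: ler_wpM2r.
      apply: divr_ge0 => //; apply: mulr_ge0; apply: exprn_ge0; apply: ltW => //.
      exact: divr_gt0.
    rewrite lerXn2r ?nnegrE ?(ltW I0)//; last exact: bump_mass_lower.
    by apply: exprn_ge0; apply: divr_ge0; [exact: ltW|apply: ltW; exact: mulr_gt0].
  rewrite -exprM (mulnC n l).
  have -> : del / 4 = (2 * N)^-1 * (del * N / 2) by field; rewrite gt_eqF.
  by rewrite !exprMn; ring.
apply: (@integral_ge_box _ _ _ (const_mx (5 / 4 * (del * N))) (const_mx (7 / 4 * (del * N)))) => //.
- move=> i j; rewrite !mxE; apply: ler_wpM2r; first exact: ltW.
  by lra.
- rewrite -prod_prod_const; apply: eq_bigr => i _; apply: eq_bigr => j _.
  by rewrite !mxE; field.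
- by apply: mulr_ge0; [apply: divr_ge0 => //; exact: ltW|apply: exprn_ge0; exact: ltW].
- move=> xi xab; apply: le_trans (lowb xi).
  apply: ler_wpM2l; first by rewrite divr_ge0// ltW.
  apply: tbump0_lower => i j; have := xab i j; rewrite !mxE => /andP[h1 h2].
  have g1 : 5 / 4 <= xi i j / (del * N) by rewrite ler_pdivlMr.
  have g2 : xi i j / (del * N) <= 7 / 4 by rewrite ler_pdivrMr.
  by move: g1 g2; rewrite (mulrC (xi i j)); move: (_ * xi i j) => t; lra.
Qed.

End multiplier_lower_bound.

(** * Comparison of the weighted norms *)

Section weighted_norms.
Context {R : realType} (n : nat).
Local Notation E := 'rV[R]_n.
Local Notation normc := (@Normc.normc R).
Local Notation leb := (@lebesgue_mx R 1 n).
Local Notation e := (const_mx 1 : E).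
Variable al : R.
Hypothesis ald : 0 < al < (1 * n)%:R.

Lemma norm_ones_ge : 1 <= `|e|.
Proof.
have n0 : (0 < n)%N by rewrite -(mul1n n); exact: dim_gt0 ald.
by have := entry_le_norm e ord0 (Ordinal n0); rewrite mxE normr1.
Qed.

(** The bump is carried by |x| <= 1 / N, where the zero of the weight contributes
    N ^ (- al (r - 1)) and the pole is far away. *)
Lemma lp_test_bump_le (r P N : R) : 1 < r -> 0 < P -> 2 <= N ->
  (0 <= lp_norm P (two_pole al r) (test_bump N : E -> R[i]) <=
   ((2 `^ al * 2 ^+ n * N `^ (- (al * (r - 1) + n%:R))) `^ P^-1)%:E)%E.
Proof.
move=> r1 P0 N2; have N0 : 0 < N by exact: lt_le_trans N2.
have al0 : 0 < al by case/andP: ald.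
have r10 : 0 < r - 1 by rewrite subr_gt0.
rewrite /lp_norm poweR_ge0/= -poweR_EFin.
have i0 : (0 <= \int[leb]_x (normc (test_bump N x : R[i]) `^ P * two_pole al r x)%:E)%E.
  by apply: integral_ge0 => x _; rewrite lee_fin mulr_ge0 ?powR_ge0 ?two_pole_ge0.
have c0 : 0 <= 2 `^ al * N `^ (- (al * (r - 1))) :> R by rewrite mulr_ge0 ?powR_ge0.
suff iB : (\int[leb]_x (normc (test_bump N x : R[i]) `^ P * two_pole al r x)%:E <=
    (2 `^ al * 2 ^+ n * N `^ (- (al * (r - 1) + n%:R)))%:E)%E.
  apply: gt0_ler_poweR => //; first by rewrite invr_ge0 ltW.
    by rewrite in_itv/= leey andbT.
  by rewrite in_itv/= leey andbT; exact: le_trans iB.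
apply: (@le_trans _ _ (\int[leb]_x ((2 `^ al * N `^ (- (al * (r - 1)))) *
    \1_(cball 0 N^-1) x)%:E)%E); last first.
  rewrite integral_cball_cst ?invr_ge0 ?(ltW N0)// lee_fin mul1n.
  rewrite opprD powRD ?(gt_eqF N0) ?implybT//.
  rewrite (powR_invn n (ltW N0)) exprMn exprVn.
  by rewrite le_eqVlt; apply/orP; left; apply/eqP; ring.
apply: ge0_integral_mono => x _; rewrite lee_fin.
  by rewrite mulr_ge0 ?powR_ge0 ?two_pole_ge0.
rewrite normc_real (ger0_norm (tbump_ge0 _ _ _ _)) -/(tbump0 N 0 x).
have [xN|xN] := leP `|x| N^-1; last first.
  by rewrite test_bump_support// powR0 ?gt_eqF// mul0r mulr_ge0.
rewrite indicE mem_set ?mulr1; last by rewrite /cball/= subr0.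
apply: (@le_trans _ _ (1 * two_pole al r x)).
  apply: ler_wpM2r; first exact: two_pole_ge0.
  have <- : 1 `^ P = 1 :> R by rewrite powR1.
  apply: ge0_ler_powR; rewrite ?nnegrE ?(ltW P0)//.
    exact: tbump_ge0.
  exact: tbump0_le1.
rewrite mul1r /two_pole two_pole_powE; apply: ler_pM; rewrite ?powR_ge0//.
  have xe : 2^-1 <= `|x - e|.
    have := ler_distD x e 0; rewrite !subr0 distrC => h1.
    have h2 := norm_ones_ge; have h3 : N^-1 <= 2^-1 by rewrite lef_pV2 ?posrE.
    have : N^-1 <= 2^-1 by [].
    by move: xN h3; move: (N^-1) => M ? ? _; lra.
  apply: le_trans (powRN_anti (ltW al0) _ xe) _; first by rewrite invr_gt0.
  by rewrite -(powR_inv1 (ler0n R 2)) -powRrM mulrNN mul1r.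
rewrite (_ : - (al * (r - 1)) = -1 * (al * (r - 1))); last by rewrite mulN1r.
rewrite (powRrM N (-1)) powR_inv1 ?(ltW N0)//.
apply: ge0_ler_powR; rewrite ?nnegrE ?invr_ge0 ?(ltW N0)//.
by rewrite mulr_ge0// ltW.
Qed.

Lemma two_pole_lower (r N : R) (x : E) : 1 < r -> 0 < N -> x != e ->
  `|x - e| <= N^-1 -> 1 <= `|x| -> N `^ al <= two_pole al r x.
Proof.
move=> r1 N0 xe xN x1; have al0 : 0 < al by case/andP: ald.
rewrite /two_pole two_pole_powE -[leLHS]mulr1; apply: ler_pM; rewrite ?powR_ge0//.
  apply: le_trans (powRN_anti (ltW al0) _ xN); last by rewrite normr_gt0 subr_eq0.
  by rewrite -(powR_inv1 (ltW N0)) -powRrM mulrNN mul1r.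
rewrite -[leLHS](powRr0 `|x|); apply: ler_powR => //.
by rewrite mulr_ge0 ?subr_ge0 ?ltW.
Qed.

(** Every w_j is at least N ^ al around the pole, and so is their weighted
    geometric mean, the joint weight. *)
Lemma lp_lower_near_pole (l : nat) (r : 'I_l -> R) (p N c0 : R) (g : E -> R[i]) :
  (0 < l)%N -> (forall j, 1 < r j) -> 0 < p -> 1 <= N -> 0 < c0 ->
  (forall x, `|x - e| <= N^-1 -> c0 <= normc (g x)) ->
  (((c0 `^ p * 2 ^- n * N `^ (al - n%:R)) `^ p^-1)%:E <=
    lp_norm p (joint_weight r (fun j => two_pole al (r j))) g)%E.
Proof.
move=> l0 r1 p0 N1 c00 gc; have N0 : 0 < N by exact: lt_le_trans N1.
have NV0 : 0 < N^-1 by rewrite invr_gt0.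
have n0 : (0 < n)%N by rewrite -(mul1n n); exact: dim_gt0 ald.
rewrite /lp_norm -poweR_EFin.
have H0 := harmonic_gt0 l0 r1.
have iB : ((c0 `^ p * 2 ^- n * N `^ (al - n%:R))%:E <= \int[leb]_x
    (normc (g x) `^ p * joint_weight r (fun j => two_pole al (r j)) x)%:E)%E.
  rewrite (_ : c0 `^ p * _ * _ = (c0 `^ p * N `^ al) * (2^-1 * N^-1) ^+ n); last first.
    rewrite powRD ?(gt_eqF N0) ?implybT// (powR_invn n (ltW N0)) exprMn !exprVn; ring.
  (* As nonzero powers of 0 are 0, the weight vanishes at e: the box avoids it. *)
  apply: (@integral_ge_box _ _ _ (const_mx (1 + N^-1 / 4)) (const_mx (1 + 3 / 4 * N^-1))) => //.
  - by move=> i j; rewrite !mxE; lra.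
  - transitivity (\prod_(i < 1) \prod_(j < n) (2^-1 * N^-1)); last first.
      by rewrite prod_prod_const mul1n.
    apply: eq_bigr => i _; apply: eq_bigr => j _.
    by rewrite !mxE; move: (N^-1) => M; field.
  - by rewrite mulr_ge0 ?powR_ge0.
  - by move=> x _; rewrite mulr_ge0 ?powR_ge0 ?joint_weight_ge0.
  - move=> x xab; have xij i j := xab i j.
    have xN : `|x - e| <= N^-1.
      apply: mx_norm_le => [|i j]; first exact: ltW.
      have := xij i j; rewrite !mxE ler_norml.
      by move: (N^-1) NV0 => M ? ?; lra.
    have x1 : 1 <= `|x|.
      apply: le_trans (entry_le_norm x ord0 (Ordinal n0)).
      apply: le_trans (ler_norm _); have := xij ord0 (Ordinal n0); rewrite !mxE.
      by move: (N^-1) NV0 => M ? ?; lra.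
    have xe : x != e.
      apply/eqP => xE; have := xij ord0 (Ordinal n0); rewrite xE !mxE.
      by move: (N^-1) NV0 => M ? ?; lra.
    apply: ler_pM; rewrite ?powR_ge0//.
      by apply: ge0_ler_powR; rewrite ?nnegrE ?(ltW p0) ?(ltW c00) ?normc_ge0// gc.
    rewrite -[leLHS](prod_powR_ge0 l0 r1 (powR_ge0 N al)).
    apply: ler_prod => j _; rewrite powR_ge0/=.
    have rj : 0 < r j by apply: lt_trans (r1 j).
    apply: ge0_ler_powR; rewrite ?nnegrE ?powR_ge0 ?two_pole_ge0 ?divr_ge0 ?(ltW H0) ?(ltW rj)//.
    exact: two_pole_lower.
have c1 : 0 <= c0 `^ p * 2 ^- n * N `^ (al - n%:R).
  by rewrite mulr_ge0 ?powR_ge0// mulr_ge0 ?powR_ge0// invr_ge0 exprn_ge0.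
apply: gt0_ler_poweR => //; first by rewrite invr_ge0 ltW.
  by rewrite in_itv/= leey andbT lee_fin.
by rewrite in_itv/= leey andbT; apply: le_trans iB.
Qed.

End weighted_norms.

Lemma powR_unbounded (R : realType) (g B : R) : 0 < g ->
  exists2 N : R, 2 <= N & B < N `^ g.
Proof.
move=> g0; exists (2 + (`|B| + 1) `^ g^-1); first by rewrite lerDl powR_ge0.
have B0 : 0 < `|B| + 1 by rewrite ltr_wpDl.
apply: (@lt_le_trans _ _ (`|B| + 1)).
  by rewrite (le_lt_trans (ler_norm B))// ltrDl.
have BE : `|B| + 1 = ((`|B| + 1) `^ g^-1) `^ g.
  by rewrite -powRrM mulVf ?gt_eqF// powRr1// ltW.
rewrite {1}BE.
apply: ge0_ler_powR; rewrite ?nnegrE ?(ltW g0) ?powR_ge0//.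
by rewrite lerDr.
Qed.

Theorem theorem1 (R : realType) (n l : nat) (n_gt0 : (0 < n)%N)
    (l_gt0 : (0 < l)%N) (Psi : 'M[R]_(l, n) -> R[i])
    (hPsi : dyadic_partition Psi)
    (s q p : R) (P : 'I_l -> R)
    (s_gt : (n * l)%:R / 2 < s) (s_le : s <= (n * l)%:R)
    (q_gt0 : 0 < q)
    (P_ge : forall j, Num.max q ((n * l)%:R / s) <= P j)
    (pE : p^-1 = \sum_j (P j)^-1)
    (bounded : forall w : 'I_l -> 'rV[R]_n -> R,
      multiple_weight (fun j => P j / q) w ->
      exists2 C : R, 0 < C &
        forall sigma : 'M[R]_(l, n) -> R[i],
          symbol sigma -> (symbol_norm s Psi sigma < +oo)%E ->
          bounded_by P w p (joint_weight (fun j => P j / q) w)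
            (multiplier sigma) (C%:E * symbol_norm s Psi sigma)%E) :
  (n * l)%:R / s <= q.
Proof.
rewrite leNgt; apply/negP => qs.
have nl0 : 0 < (n * l)%:R :> R by rewrite ltr0n muln_gt0 n_gt0.
have s0 : 0 < s by apply: lt_trans s_gt; rewrite divr_gt0.
have l0 : 0 < l%:R :> R by rewrite ltr0n.
have qP j : q < P j.
  by apply: lt_le_trans qs _; apply: le_trans (P_ge j); rewrite le_max lexx orbT.
have P0 j : 0 < P j by exact: lt_trans (qP j).
have r1 j : 1 < P j / q by rewrite ltr_pdivlMr// mul1r.
have p0 : 0 < p.
  rewrite -invr_gt0 pE (bigD1 (Ordinal l_gt0))//= ltr_pwDl ?invr_gt0//.
  by apply: sumr_ge0 => j _; rewrite invr_ge0 ltW.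
have sqn : s * q / l%:R < n%:R.
  by rewrite ltr_pdivrMr// -natrM mulrC -ltr_pdivlMr.
have sq0 : 0 < s * q / l%:R by rewrite divr_gt0// mulr_gt0.
(* Below the critical exponent n, but large enough for the final comparison of
   powers of N: s < l * al / q. *)
pose al : R := (s * q / l%:R + n%:R) / 2.
have al0 : 0 < al by rewrite /al; lra.
have aln : al < n%:R by rewrite /al; lra.
have alsq : s < l%:R * al / q.
  by rewrite ltr_pdivlMr// (mulrC l%:R) -ltr_pdivrMr// /al; lra.
have ald : 0 < al < (1 * n)%:R by rewrite al0 mul1n.
have d0 : (0 < l * n)%N by rewrite muln_gt0 l_gt0.
have s0d : 0 <= s <= (l * n)%:R by rewrite (ltW s0) mulnC.
have [C C0 HC] := bounded _ (multiple_weight_two_pole ald l_gt0 r1).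
have [K K0 HK] := symbol_norm_osc_le d0 hPsi s0d.
have [del [c0 [del0 deld c00 HT]]] := @multiplier_lower R n l n_gt0 l_gt0.
pose A : R := (c0 `^ p * 2 ^- n) `^ p^-1.
pose b (N : R) j := (2 `^ al * 2 ^+ n * N `^ (- (al * (P j / q - 1) + n%:R))) `^ (P j)^-1.
have main (N : R) : 2 <= N ->
    (c0 `^ p * 2 ^- n * N `^ (al - n%:R)) `^ p^-1 <= C * (K * N `^ s) * \prod_j b N j.
  move=> N2; have N1 : 1 <= N by apply: le_trans N2; rewrite ler1n.
  have sN := HK del N del0 deld N1.
  have fS : forall j : 'I_l, schwartz (test_bump N : 'rV[R]_n -> R[i]).
    by move=> j; apply: schwartz_tbump; exact: lt_le_trans N1.
  have so : symbol (osc_symbol del N : 'M[R]_(l, n) -> R[i]) by exact: symbol_osc.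
  have := HC (osc_symbol del N) so (le_lt_trans sN (ltry _)) _ fS.
  move=> H; rewrite -lee_fin.
  apply: le_trans (lp_lower_near_pole ald l_gt0 r1 p0 N1 c00 (fun x => HT N x N1)) _.
  apply: le_trans H _; rewrite 2!EFinM.
  have sn0 : (0 <= symbol_norm s Psi (osc_symbol del N))%E.
    apply: (@le_trans _ _ (sobolev s (fun xi => osc_symbol del N (2 ^ (0 : int) *: xi) *
      fourier Psi xi))); first exact: poweR_ge0.
    by apply: ereal_sup_ubound; exists 0.
  have /andP[pr0 pr1] := lee_prod_EFin (fun j => lp_test_bump_le ald (r1 j) (P0 j) N2).
  apply: lee_pmul => //; first by apply: mule_ge0 => //; rewrite lee_fin ltW.
  by apply: lee_wpmul2l => //; rewrite lee_fin ltW.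
pose S := \sum_j (al * (P j / q - 1) + n%:R) / P j.
pose B := C * K * \prod_j (2 `^ al * 2 ^+ n) `^ (P j)^-1.
(* The terms in p and P j combine by the relation between these exponents. *)
have SE : (al - n%:R) * p^-1 + S = l%:R * al / q.
  have -> : l%:R * al / q = \sum_(j < l) al / q.
    by rewrite sumr_const card_ord -[RHS]mulr_natl mulrA.
  rewrite pE mulr_sumr -big_split/=; apply: eq_bigr => j _; field.
  by rewrite !gt_eqF.
have A0 : 0 < A.
  by apply: powR_gt0; apply: mulr_gt0; [exact: powR_gt0|rewrite invr_gt0 exprn_gt0].
have bound (N : R) : 2 <= N -> A * N `^ (l%:R * al / q - s) <= B.
  move=> N2; have N0 : 0 < N by exact: lt_le_trans N2.
  have := main N N2.
  rewrite powRM ?powR_ge0//; last first.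
    by apply: mulr_ge0; [exact: powR_ge0|rewrite invr_ge0 exprn_ge0].
  rewrite -powRrM -/A.
  have -> : \prod_j b N j = \prod_j (2 `^ al * 2 ^+ n) `^ (P j)^-1 * N `^ (- S).
    rewrite /S -sumrN -(prod_powR _ N0) -big_split/=; apply: eq_bigr => j _.
    rewrite /b (powRM _ (mulr_ge0 (powR_ge0 2 al) (exprn_ge0 n (ler0n R 2))) (powR_ge0 _ _)).
    by rewrite -powRrM mulNr.
  move=> H; have NS : 0 < N `^ (S - s) by exact: powR_gt0.
  rewrite -SE (_ : _ + S - s = (al - n%:R) * p^-1 + (S - s)); last ring.
  rewrite powRD ?(gt_eqF N0) ?implybT// mulrA.
  apply: le_trans (ler_wpM2r (ltW NS) H) _.
  rewrite [leLHS](_ : _ = B * (N `^ s * N `^ (- S) * N `^ (S - s))); last by rewrite /B; ring.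
  rewrite -!powRD ?(gt_eqF N0) ?implybT//.
  by rewrite (_ : s + _ + _ = 0) ?powRr0 ?mulr1//; ring.
have [N N2 BN] := @powR_unbounded R (l%:R * al / q - s) (B / A) ltac:(by rewrite subr_gt0).
have := bound N N2; rewrite leNgt => /negP; apply.
by rewrite mulrC -ltr_pdivrMr.
Qed.
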